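(* Let $\xi$ be a positive random variable with density $f$ such that for some positive constants $C$ and $p$, $f(t)\sim Ct^{-p-1}$ as $t\to\infty$. Let $\xi_1,\xi_2$ be independent copies of $\xi$, independent of a one-dimensional Brownian motion $Y$ with $Y_0=0$. Let $\eta_{(-\xi_1,\xi_2)}=\inf\{t\ge0:Y_t\notin(-\xi_1,\xi_2)\}$. Then as $t\to\infty$, $$P(\eta_{(-\xi_1,\xi_2)}>t)\approx\begin{cases}t^{-p},&p<1,\\ t^{-1}\ln t,&p=1,\\ t^{-(p+1)/2},&p>1.\end{cases}$$
   Context: $f\approx g$ as $t\to\infty$ means there exist constants $0<C_1\le C_2$ with $C_1\le f(t)/g(t)\le C_2$ for all sufficiently large $t$; $f\sim g$ means $f/g\to1$. *)

(* Defs.v *)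
From HB Require Import structures.
From mathcomp Require Import all_boot all_order all_algebra.
From mathcomp Require Import all_classical all_reals all_analysis.
Set Implicit Arguments. Unset Strict Implicit. Unset Printing Implicit Defensive.
Import Order.TTheory GRing.Theory Num.Theory.
Import numFieldNormedType.Exports.
Local Open Scope classical_set_scope.
Local Open Scope ring_scope.

Definition sigma_rv d (T : measurableType d) (R : realType) (X : T -> R)
  : set (set T) :=
  <<s preimage_set_system setT X measurable >>.

Definition sigma_proc d (T : measurableType d) (R : realType) (Y : R -> T -> R)
  : set (set T) :=
  <<s \bigcup_(s in [set s : R | 0 <= s]) preimage_set_system setT (Y s) measurable >>.

(* mutual independence of three sub-sigma-algebras (each contains setT, so the
   pairwise product rules follow from the triple one) *)
Definition indep3 d (T : measurableType d) (R : realType) (P : probability T R)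
  (F1 F2 F3 : set (set T)) : Prop :=
  forall A1 A2 A3, F1 A1 -> F2 A2 -> F3 A3 ->
    P (A1 `&` A2 `&` A3) = (P A1 * P A2 * P A3)%E.

Definition has_density d (T : measurableType d) (R : realType) (P : probability T R)
  (X : T -> R) (f : R -> R) : Prop :=
  measurable_fun setT X /\ measurable_fun setT f /\ (forall x, 0 <= f x) /\
  forall B : set R, measurable B ->
    P (X @^-1` B) = (\int[lebesgue_measure]_(x in B) (f x)%:E)%E.

Definition brownian_motion d (T : measurableType d) (R : realType)
  (P : probability T R) (Y : R -> T -> R) : Prop :=
  (forall s, measurable_fun setT (Y s)) /\
  (forall w, Y 0 w = 0) /\
  (forall w, {within [set s : R | 0 <= s], continuous (fun s => Y s w)}) /\
  (forall (n : nat) (t : nat -> R) (B : nat -> set R),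
     t 0%N = 0 -> (forall k, (k < n)%N -> t k < t k.+1) ->
     (forall k, (k < n)%N -> measurable (B k)) ->
     P (\bigcap_(k in `I_ n) [set w | B k (Y (t k.+1) w - Y (t k) w)]) =
     \big[*%E/1%E]_(k < n) normal_prob 0 (Num.sqrt (t k.+1 - t k)) (B k)).

(* exit time of Y from the (random) interval (-a, b): inf {t >= 0 : Y_t notin (-a,b)},
   with inf of the empty set = +oo *)
Definition exit_time d (T : measurableType d) (R : realType) (Y : R -> T -> R)
  (a b : T -> R) (w : T) : \bar R :=
  ereal_inf [set s%:E | s in [set s : R | 0 <= s /\ ~ (- a w < Y s w < b w)]].

Definition rate (R : realType) (p t : R) : R :=
  if p < 1 then t `^ (- p)
  else if p == 1 then ln t / t
  else t `^ (- ((p + 1) / 2)).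

(* Main.v *)
(** Given the endpoints a <= b of a deterministic interval (-a, b), the exit time
exceeds r^2 with probability at most a constant times (a / r) (b / r)^n for any
n: on the first half of the time the path stays above -a, and on the second half
n successive increments are at most 2b in absolute value. Conversely it is at
least a constant times a / r when b is a large multiple of r. Both one-sided
estimates come from random walks with Gaussian steps, sampled on finer and finer
grids, by comparing the survival probability with a polynomial in space and time
that is super- or sub-caloric; an overshoot of fixed size has probability
O(1 / N^2) per step, so the error vanishes with the mesh 1 / N.

Splitting the endpoints dyadically, xi ~ 2^i A has probability of order th^i with
th = 2^-p, and independence gives, for t = (2^M A)^2, that P(exit > t) is of order
(th / 2)^M sum_(i <= M) (2 th)^i. The three regimes of the rate are those of this
geometric sum: ratio 2 th > 1, = 1 or < 1. *)
Require Import Defs.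
From HB Require Import structures.
From mathcomp Require Import all_boot all_order all_algebra.
From mathcomp Require Import all_classical all_reals all_analysis.
From mathcomp Require Import measurable_realfun ring lra.
Import Order.TTheory GRing.Theory Num.Theory.
Import numFieldNormedType.Exports.
Local Open Scope classical_set_scope.
Local Open Scope ring_scope.

Set Implicit Arguments. Unset Strict Implicit. Unset Printing Implicit Defensive.

(** * Survival of random walks *)

(** Endpoints and path meet only through [indep3], and nothing is conditioned on the endpoints.
    Every path event used in a product is written with deterministic levels and countably many
    times, so it lies in [sigma_proc Y] and the triple product rule applies directly. One finite
    grid suffices for upper bounds, since staying in an interval implies staying there at grid
    times; lower bounds need all dyadic grids and the continuity of the path.

    The power n is what saves the sum over pairs of scales. With n = 1 both endpoints would
    contribute a geometric sum of ratio 2 th, and the product would be too large for p >= 1. Once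
    2^n th >= 2, the larger endpoint is dominated by its top scale and contributes th^M, which
    leaves a single sum of ratio 2 th for the smaller one. *)

Section freezing.
Context (R : realType) (d : measure_display) (T : measurableType d).
Variables (P : probability T R) (G : set (set T)) (X : T -> R)
  (nu : probability R R).
Hypothesis mG : forall A, <<s G >> A -> measurable A.
Hypothesis mX : measurable_fun setT X.
Hypothesis indX : forall A B, <<s G >> A -> measurable B ->
  P (A `&` X @^-1` B) = (P A * nu B)%E.

Local Notation TG := (g_sigma_algebraType G : measurableType G.-sigma).
Let idG : T -> TG := id.

Let midG : measurable_fun setT idG.
Proof. by move=> _ A mA; rewrite setTI; exact: mG. Qed.

Let midG_mixin := isMeasurableFun.Build _ _ _ _ idG midG.
Let midG_pack : {mfun T >-> TG} := HB.pack idG midG_mixin.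

Let PG : probability TG R := distribution P midG_pack.

Let pairX : T -> TG * R := fun w => (idG w, X w).

Let mpairX : measurable_fun setT pairX.
Proof. exact: measurable_fun_pair. Qed.

Let mpairX_mixin := isMeasurableFun.Build _ _ _ _ pairX mpairX.
Let mpairX_pack : {mfun T >-> (TG * R)%type} := HB.pack pairX mpairX_mixin.

(** The law of (w, X w) on [TG * R] is the product of [PG] and [nu], because [indX] says so on
    rectangles; the identity is then Tonelli's theorem. Here [PG] is [P] restricted to the
    sigma-algebra generated by [G], obtained as the law of the identity map. *)
Lemma freezing (h : TG * R -> \bar R) :
  measurable_fun setT h -> (forall z, (0 <= h z)%E) ->
  (\int[P]_w h (w, X w) = \int[P]_w \int[nu]_x h (w, x))%E.
Proof.
move=> mh h0.
have prodE : forall E, measurable E ->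
    (PG \x nu)%E E = distribution P mpairX_pack E.
  apply: product_measure_unique => A B mA mB.
  by rewrite /distribution/= /pushforward -indX.
transitivity (\int[distribution P mpairX_pack]_z h z)%E.
  by rewrite ge0_integral_pushforward.
transitivity (\int[(PG \x nu)%E]_z h z)%E.
  by apply: eq_measure_integral => A mA _; exact/esym/prodE.
rewrite fubini_tonelli1//.
rewrite /PG/= ge0_integral_pushforward//.
- exact: measurable_fun_fubini_tonelli_F.
- by move=> y _; exact: integral_ge0.
Qed.
End freezing.

(** Probability that the walk with step law [nu] started at [y] lies in [I] at each of the times 0,
    ..., [j], computed by conditioning on the first step. *)
Fixpoint surv (R : realType) (nu : probability R R) (I : set R) (j : nat)
    (y : R) : \bar R :=
  if j is j'.+1 then ((\1_I y)%:E * \int[nu]_x @surv R nu I j' (y + x)%R)%E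
  else (\1_I y)%:E.

Section surv_theory.
Context (R : realType) (nu : probability R R) (I : set R).
Hypothesis mI : measurable I.

Lemma surv_ge0 j y : (0 <= surv nu I j y)%E.
Proof.
elim: j y => [|j ih] y /=; first by rewrite lee_fin indicE.
by rewrite mule_ge0 ?lee_fin ?indicE//; apply: integral_ge0 => x _; exact: ih.
Qed.

Lemma measurable_surv j : measurable_fun setT (surv nu I j).
Proof.
elim: j => [|j ih] /=; first exact/measurable_EFinP/measurable_indic.
apply: emeasurable_funM; first exact/measurable_EFinP/measurable_indic.
apply: (measurable_fun_fubini_tonelli_F (m2 := nu)
  (fun z : R * R => surv nu I j (z.1 + z.2)%R)).
- by apply: measurableT_comp => //; exact: measurable_funD.
- by move=> z; exact: surv_ge0.
Qed.

Lemma surv_out j y : ~ I y -> surv nu I j y = 0%E.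
Proof.
move=> Iy; have I0 : (\1_I y : R) = 0 by rewrite indicE memNset.
by case: j => [|j] /=; rewrite I0 ?mul0e.
Qed.

Lemma surv_in j y : I y -> surv nu I j.+1 y = (\int[nu]_x surv nu I j (y + x)%R)%E.
Proof. by move=> Iy /=; rewrite indicE mem_set// mul1e. Qed.

Lemma surv_le1 j y : (surv nu I j y <= 1)%E.
Proof.
elim: j y => [|j ih] y; first by rewrite /= lee_fin indicE; case: (_ \in _).
have [Iy|Iy] := pselect (I y); last by rewrite surv_out// lee01.
rewrite surv_in// (@le_trans _ _ (\int[nu]_x (cst 1%E x))%E)//.
  apply: ge0_le_integral => //.
  - by move=> x _; exact: surv_ge0.
  - by apply: measurableT_comp; [exact: measurable_surv|exact: measurable_funD].
rewrite integral_cst// mul1e. exact: probability_le1.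
Qed.
End surv_theory.

Section walk.
Context (R : realType) (d : measure_display) (T : measurableType d).
Variables (P : probability T R) (S : nat -> T -> R)
  (nu_ : nat -> probability R R).
Hypothesis mS : forall k, measurable_fun setT (S k).
Hypothesis S0 : forall w, S 0%N w = 0.
Hypothesis boxP : forall n (B : nat -> set R), (forall k, measurable (B k)) ->
  P (\bigcap_(k in `I_n) [set w | B k (S k.+1 w - S k w)]) =
  \big[*%E/1%E]_(k < n) nu_ k (B k).

(** A pi-system generating the history of the first [k] increments. *)
Definition box (k : nat) : set (set T) :=
  [set D | exists2 B : nat -> set R, (forall i, measurable (B i)) &
    D = \bigcap_(i in `I_k) [set w | B i (S i.+1 w - S i w)]].

Local Lemma mincr k : measurable_fun setT (fun w => S k.+1 w - S k w).
Proof. exact: measurable_funB. Qed.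

Local Lemma mincr_pre k B : measurable B -> measurable [set w | B (S k.+1 w - S k w)].
Proof. by move=> mB; rewrite -[X in measurable X]setTI; exact: mincr. Qed.

Local Lemma box_measurable k A : <<s box k >> A -> measurable A.
Proof.
apply: smallest_sub; first exact: sigma_algebra_measurable.
move=> _ [B mB ->]; apply: bigcap_measurableType => i _; exact: mincr_pre.
Qed.

Local Lemma box_setT k : box k setT.
Proof. by exists (fun=> setT) => //; apply/seteqP; split. Qed.

Local Lemma box_setI k : setI_closed (box k).
Proof.
move=> _ _ [B mB ->] [C mC ->]; exists (fun i => B i `&` C i).
  by move=> i; exact: measurableI.
apply/seteqP; split=> w /=.
  by move=> [wB wC] i ik; split; [exact: wB|exact: wC].
by move=> wBC; split=> i ik; have [] := wBC i ik.
Qed.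

(** Both sides are finite measures in [A], and they agree on the pi-system [box k] by [boxP] with
    one more coordinate. *)
Local Lemma walk_indep k A B : <<s box k >> A -> measurable B ->
  P (A `&` [set w | B (S k.+1 w - S k w)]) = (P A * nu_ k B)%E.
Proof.
move=> kA mB; have mXB := mincr_pre k mB.
pose m1 := mrestr P mXB.
have nuB0 : 0 <= fine (nu_ k B) by exact/fine_ge0.
pose m2 := mscale (NngNum nuB0) P.
have nuBE : (fine (nu_ k B))%:E = nu_ k B.
  by rewrite fineK// fin_num_measure.
have m2E X : m2 X = (P X * nu_ k B)%E.
  by rewrite muleC -nuBE.
have m12 : m1 A = m2 A; last by rewrite -m2E -m12.
apply: (g_sigma_algebra_measure_unique (box k) _ (fun=> setT)) => //.
- by move=> X kX; apply: (box_measurable (k := k)); exact: sub_sigma_algebra.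
- by move=> _; exact: box_setT.
- by rewrite bigcup_const//; exists 0%N.
- exact: box_setI.
- move=> _ [C mC ->]; rewrite [RHS]m2E /m1 /mrestr.
  rewrite boxP//.
  pose C' i := if (i < k)%N then C i else B.
  have mC' i : measurable (C' i) by rewrite /C'; case: ifP.
  have CE : C' k = B by rewrite /C' ltnn.
  have := boxP k.+1 mC'; rewrite big_ord_recr/= CE => h.
  rewrite -[in RHS](_ : (\big[*%E/1%E]_(i < k) nu_ i (C' i) =
    \big[*%E/1%E]_(i < k) nu_ i (C i))%E); last first.
    by apply: eq_bigr => i _; rewrite /C' ltn_ord.
  rewrite -h; congr (P _); apply/seteqP; split=> w /=.
    move=> [wC wB] i /=; rewrite ltnS leq_eqVlt => /orP[/eqP->|ik].
      by rewrite /C' ltnn.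
    by rewrite /C' ik; exact: wC.
  move=> wC; split.
    by move=> i /= ik; have := wC i; rewrite /= ltnS /C' ik; apply; exact: ltnW.
  by have := wC k; rewrite /= ltnS leqnn /C' ltnn; apply.
- by move=> _; rewrite (le_lt_trans (probability_le1 P _)) ?ltry//; exact: measurableI.
Qed.

Local Lemma walk_adapted k i B : (i <= k)%N -> measurable B ->
  <<s box k >> (S i @^-1` B).
Proof.
move=> ik mB.
suff : measurable_fun setT (S i : g_sigma_algebraType (box k) -> R).
  by move=> /(_ measurableT B mB); rewrite setTI.
elim: i ik {B mB} => [|i ih] ik.
  by rewrite (_ : S 0 = cst 0)//; apply/funext => w; rewrite S0.
rewrite (_ : S i.+1 = (fun w => S i w + (S i.+1 w - S i w))); last first.
  by apply/funext => w; rewrite addrC subrK.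
apply: (@measurable_funD _ (g_sigma_algebraType (box k))).
  by apply: ih; exact: ltnW.
move=> _ B mB; rewrite setTI; apply: sub_sigma_algebra.
exists (fun j => if j == i then B else setT); first by move=> j; case: ifP.
apply/seteqP; split=> w /=.
  by move=> wB j jk; case: ifPn => // /eqP ->.
by move=> /(_ i); rewrite /= eqxx; exact.
Qed.

Definition stays (I : set R) (k : nat) : set T :=
  \bigcap_(i in `I_k) (S i @^-1` I).

Variable I : set R.
Hypothesis mI : measurable I.

(** [stays I k] looks only at times below [k], so for positive [k] the first [k - 1] increments
    decide it. *)
Local Lemma stays_adapted k m : (k <= m.+1)%N -> <<s box m >> (stays I k).
Proof.
move=> km; apply: (@bigcap_measurableType _ (g_sigma_algebraType (box m))).
by move=> i ik; apply: walk_adapted => //; rewrite -ltnS; exact: leq_trans km.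
Qed.

(** The Markov property for one step: [freezing] applied with the history up to time [k] frozen and
    the next increment integrated out. *)
Local Lemma walk_step nu k (v : R -> \bar R) D : nu_ k = nu -> <<s box k >> D ->
  measurable_fun setT v -> (forall x, (0 <= v x)%E) ->
  (\int[P]_(w in D) \int[nu]_x v (S k w + x)%R = \int[P]_(w in D) v (S k.+1 w))%E.
Proof.
move=> nuk kD mv v0.
have mSk : measurable_fun setT (S k : g_sigma_algebraType (box k) -> R).
  by move=> _ B mB; rewrite setTI; exact: walk_adapted.
pose h (z : g_sigma_algebraType (box k) * R) : \bar R :=
  ((\1_D z.1)%:E * v (S k z.1 + z.2)%R)%E.
have mh : measurable_fun setT h.
  apply: emeasurable_funM.
    apply/measurable_EFinP.
    apply: (measurableT_comp (f := \1_D : g_sigma_algebraType (box k) -> R)) => //.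
  apply: measurableT_comp => //; apply: measurable_funD => //.
  exact: measurableT_comp.
have h0 z : (0 <= h z)%E by rewrite mule_ge0// lee_fin.
have := freezing (@box_measurable k) (mincr k) (@walk_indep k) mh h0.
move=> hE; rewrite integral_mkcond [RHS]integral_mkcond.
transitivity (\int[P]_w (h (w, S k.+1 w - S k w)%R))%E.
  rewrite hE; apply: eq_integral => w _; rewrite patchE /h/= indicE nuk.
  case: ifPn => wD.
    by apply: eq_integral => x _; rewrite mul1e.
  by rewrite integral0_eq// => x _; rewrite mul0e.
apply: eq_integral => w _; rewrite patchE /h/= indicE.
by case: ifPn => wD; rewrite ?mul0e// mul1e addrC subrK.
Qed.

Lemma walk_stays nu N : (forall k, (k < N)%N -> nu_ k = nu) ->
  P (stays I N.+1) = surv nu I N 0.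
Proof.
move=> nuE.
have staysS k w : stays I k.+1 w <-> stays I k w /\ I (S k w).
  split; first by move=> Iw; split=> [i /= ik|]; apply: Iw => /=; rewrite ltnS// ltnW.
  by move=> [Iw Ik] i /=; rewrite ltnS leq_eqVlt => /orP[/eqP->//|]; exact: Iw.
(* Here [k] steps are performed by the path and the remaining [j] by the recursion [surv]. Trading
   one for the other by [walk_step] leaves the integral unchanged; k = 0 gives [surv nu I N 0]. *)
have key k j : (k + j = N)%N ->
    (\int[P]_(w in stays I k) surv nu I j (S k w) = P (stays I N.+1))%E.
  elim: j k => [|j ih] k.
    rewrite addn0 => <-.
    rewrite (_ : stays I k.+1 = (S k @^-1` I) `&` stays I k); last first.
      by apply/seteqP; split=> w /=; rewrite staysS => -[].
    rewrite -integral_indic//; last 2 first.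
    - by apply: (@box_measurable k); apply: stays_adapted.
    - by apply: (@box_measurable k); exact: walk_adapted.
  rewrite addnS -addSn => kj; rewrite -(ih k.+1 kj).
  have kN : (k < N)%N by rewrite -kj leq_addr.
  rewrite -(walk_step (nuE k kN))//.
  - rewrite (integral_mkcond (stays I k)) (integral_mkcond (stays I k.+1)).
    apply: eq_integral => w _; rewrite !patchE /=.
    have [wk1|wk1] := boolP (w \in stays I k.+1).
      move: wk1; rewrite inE staysS => -[wk Iw].
      by rewrite mem_set// indicE mem_set// mul1e.
    case: ifPn => // wk; rewrite indicE memNset ?mul0e// => Iw.
    by move/negP : wk1; apply; rewrite inE staysS; split=> //; rewrite inE in wk.
  - exact: stays_adapted.
  - exact: measurable_surv.
  - by move=> x; exact: surv_ge0.
rewrite -(key 0%N N)//.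
rewrite (_ : stays I 0 = setT); last by apply/seteqP; split.
under eq_integral do rewrite S0.
by rewrite integral_cst// -[RHS]mule1; congr (_ * _)%E; exact: probability_setT.
Qed.

(** The block increments are peeled off from the last one, the rest of the event being part of the
    history before it. *)
Lemma stays_blocks N n (B : set R) : measurable B ->
  P (stays I N.+1 `&` \bigcap_(l in `I_n) [set w | B (S (N + l).+1 w - S (N + l) w)]) =
  (P (stays I N.+1) * \big[*%E/1%E]_(l < n) nu_ (N + l) B)%E.
Proof.
move=> mB; elim: n => [|n ih].
  rewrite big_ord0 mule1 II0 bigcap_set0 setIT//.
rewrite big_ord_recr/= muleA -ih -walk_indep//.
  rewrite -setIA; congr (P (_ `&` _)); apply/seteqP; split=> w /=.
    by move=> wB; split=> [l /= ln|]; apply: wB => /=; rewrite ltnS// ltnW.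
  by move=> [wB wn] l /=; rewrite ltnS leq_eqVlt => /orP[/eqP->//|]; exact: wB.
apply: (@measurableI _ (g_sigma_algebraType (box (N + n)))).
  by apply: stays_adapted; rewrite ltnS leq_addr.
apply: (@bigcap_measurableType _ (g_sigma_algebraType (box (N + n)))) => l /= ln.
apply: sub_sigma_algebra.
exists (fun j => if j == (N + l)%N then B else setT); first by move=> j; case: ifP.
apply/seteqP; split=> w /=.
  by move=> wB j jk; case: ifPn => // /eqP ->.
by move=> /(_ (N + l)%N); rewrite /= eqxx ltn_add2l; exact.
Qed.

Lemma measurable_stays k : measurable (stays I k).
Proof. by apply: (@box_measurable k); exact: stays_adapted. Qed.
End walk.

(** * Caloric comparison polynomials *)

Section symmetric_moments.
Context (R : realType) (nu : probability R R) (a2 a4 : R).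
Hypothesis nuN : forall f : R -> \bar R, measurable_fun setT f ->
  (forall x, (0 <= f x)%E) -> (\int[nu]_x f (- x)%R = \int[nu]_x f x)%E.
Hypothesis nu2 : (\int[nu]_x (x ^+ 2)%:E = a2%:E)%E.
Hypothesis nu4 : (\int[nu]_x (x ^+ 4)%:E = a4%:E)%E.

Let mshift (s : R -> R) (y : R) : measurable_fun setT s ->
  measurable_fun setT (fun x : R => (s (y + x))%:E).
Proof.
by move=> ms; apply/measurable_EFinP/measurableT_comp => //; exact: measurable_funD.
Qed.

Let mshiftN (s : R -> R) (y : R) : measurable_fun setT s ->
  measurable_fun setT (fun x : R => (s (y - x))%:E).
Proof.
move=> ms; apply/measurable_EFinP/measurableT_comp => //.
by apply: measurable_funB.
Qed.

Let mpow c n : measurable_fun setT (fun x : R => (c * x ^+ n)%:E).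
Proof. by apply/measurable_EFinP/measurable_funM => //; exact: measurable_funX. Qed.

Let int_pow c n m : 0 <= c -> ~~ odd n -> (\int[nu]_x (x ^+ n)%:E = m%:E)%E ->
  (\int[nu]_x (c * x ^+ n)%:E = (c * m)%:E)%E.
Proof.
move=> c0 on h; under eq_integral do rewrite EFinM.
rewrite ge0_integralZl_EFin//; first by rewrite h.
- by move=> x _; rewrite lee_fin exprn_even_ge0.
- by apply/measurable_EFinP; exact: measurable_funX.
Qed.

Let int_sym (s : R -> R) y : measurable_fun setT s -> (forall x, 0 <= s x) ->
  (\int[nu]_x (s (y + x) + s (y - x))%:E =
   \int[nu]_x (s (y + x))%:E + \int[nu]_x (s (y + x))%:E)%E.
Proof.
move=> ms s0; under eq_integral do rewrite EFinD.
rewrite ge0_integralD//.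
- congr (_ + _)%E; apply: (nuN (mshift y ms)) => x.
  by rewrite lee_fin.
- by move=> x _; rewrite lee_fin.
- exact: (mshift y ms).
- by move=> x _; rewrite lee_fin.
- exact: (mshiftN y ms).
Qed.

Let int_cst (c : R) : (\int[nu]_x c%:E = c%:E)%E.
Proof.
by rewrite integral_cst//; rewrite -[RHS]mule1; congr (_ * _)%E; exact: probability_setT.
Qed.

(** Pairing x with -x removes the odd terms of a polynomial minorant of [s], so only the second and
    fourth moments enter. The correction terms are placed so that only nonnegative functions are
    integrated and no integrability has to be discussed. *)
Lemma sym_integral_ge (s : R -> R) y al be ga : measurable_fun setT s ->
  (forall x, 0 <= s x) -> 0 <= al -> 0 <= be ->
  (forall x, 2 * ga <= s (y + x) + s (y - x) + al * x ^+ 2 + be * x ^+ 4) ->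
  (ga%:E <= \int[nu]_x (s (y + x))%:E + ((al * a2 + be * a4) / 2)%:E)%E.
Proof.
move=> ms s0 al0 be0 h.
have I0 : (0 <= \int[nu]_x (s (y + x))%:E)%E.
  by apply: integral_ge0 => x _; rewrite lee_fin.
have a20 : 0 <= a2.
  by rewrite -lee_fin -nu2; apply: integral_ge0 => x _; rewrite lee_fin sqr_ge0.
have a40 : 0 <= a4.
  rewrite -lee_fin -nu4; apply: integral_ge0 => x _.
  by rewrite lee_fin exprn_even_ge0.
have [ga0|ga0] := ltP ga 0.
  rewrite (@le_trans _ _ 0%E)//; first by rewrite lee_fin ltW.
  by rewrite adde_ge0// lee_fin divr_ge0// addr_ge0// mulr_ge0.
have : (\int[nu]_x (2 * ga)%:E <= \int[nu]_x ((s (y + x) + s (y - x))%:E +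
    ((al * x ^+ 2)%:E + (be * x ^+ 4)%:E)))%E.
  apply: ge0_le_integral => //.
  - by move=> x _; rewrite lee_fin mulr_ge0.
  - apply: emeasurable_funD.
      under eq_fun do rewrite EFinD.
      by apply: emeasurable_funD; [exact: (mshift y ms)|exact: (mshiftN y ms)].
    exact: emeasurable_funD.
  - by move=> x _; rewrite -!EFinD lee_fin addrA.
rewrite int_cst ge0_integralD//=; first last.
- exact: emeasurable_funD.
- move=> x _; rewrite -EFinD lee_fin addr_ge0// mulr_ge0// ?exprn_even_ge0//.
- by under eq_fun do rewrite EFinD; apply: emeasurable_funD; [exact: (mshift y ms)|exact: (mshiftN y ms)].
- by move=> x _; rewrite lee_fin addr_ge0.
rewrite int_sym// ge0_integralD//; first last.
- by move=> x _; rewrite lee_fin mulr_ge0// exprn_even_ge0.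
- by move=> x _; rewrite lee_fin mulr_ge0// exprn_even_ge0.
rewrite (int_pow _ _ nu2)// (int_pow _ _ nu4)//.
case: (\int[nu]_x _)%E I0 => [r| |]//= r0; rewrite -?EFinD ?lee_fin ?leey//.
by move=> h2; lra.
Qed.

Lemma sym_integral_le (s : R -> R) y al be ga : measurable_fun setT s ->
  (forall x, 0 <= s x) -> 0 <= al -> 0 <= be ->
  (forall x, s (y + x) + s (y - x) + al * x ^+ 2 <= 2 * ga + be * x ^+ 4) ->
  (\int[nu]_x (s (y + x))%:E + (al * a2 / 2)%:E <= (ga + be * a4 / 2)%:E)%E.
Proof.
move=> ms s0 al0 be0 h.
have I0 : (0 <= \int[nu]_x (s (y + x))%:E)%E.
  by apply: integral_ge0 => x _; rewrite lee_fin.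
have ga0 : 0 <= ga.
  have := h 0; rewrite !expr0n/= !mulr0 subr0 !addr0 => h0.
  have := s0 y; lra.
have : (\int[nu]_x ((s (y + x) + s (y - x))%:E + (al * x ^+ 2)%:E) <=
    \int[nu]_x ((2 * ga)%:E + (be * x ^+ 4)%:E))%E.
  apply: ge0_le_integral => //.
  - move=> x _; rewrite -EFinD lee_fin !addr_ge0// mulr_ge0// exprn_even_ge0//.
  - apply: emeasurable_funD => //.
    under eq_fun do rewrite EFinD.
    by apply: emeasurable_funD; [exact: (mshift y ms)|exact: (mshiftN y ms)].
  - exact: emeasurable_funD.
  - by move=> x _; rewrite -!EFinD lee_fin.
rewrite ge0_integralD//=; first last.
- by move=> x _; rewrite lee_fin mulr_ge0// exprn_even_ge0.
- by under eq_fun do rewrite EFinD; apply: emeasurable_funD; [exact: (mshift y ms)|exact: (mshiftN y ms)].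
- by move=> x _; rewrite lee_fin addr_ge0.
rewrite int_sym// ge0_integralD//; first last.
- by move=> x _; rewrite lee_fin mulr_ge0// exprn_even_ge0.
- by move=> x _; rewrite lee_fin mulr_ge0.
rewrite int_cst (int_pow _ _ nu2)// (int_pow _ _ nu4)//.
case: (\int[nu]_x _)%E I0 => [r| |]//= r0; rewrite -?EFinD ?lee_fin//.
by move=> h2; lra.
Qed.

Section with_set.
Variable I : set R.
Hypothesis mI : measurable I.

Let s j y := fine (surv nu I j y).

Let sE j y : surv nu I j y = (s j y)%:E.
Proof.
rewrite fineK// ge0_fin_numE ?surv_ge0//.
by rewrite (le_lt_trans (surv_le1 nu mI j y)) ?ltry.
Qed.

Let ms j : measurable_fun setT (s j).
Proof.
apply/measurable_EFinP; rewrite (_ : EFin \o s j = surv nu I j).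
  exact: measurable_surv.
by apply/funext => y; rewrite /= -sE.
Qed.

Let s0 j y : 0 <= s j y.
Proof. by rewrite fine_ge0// surv_ge0. Qed.

Let s1 j y : s j y <= 1.
Proof. by rewrite -lee_fin -sE; exact: surv_le1. Qed.

Let sout j y : ~ I y -> s j y = 0.
Proof. by move=> Iy; rewrite /s surv_out. Qed.

Let sin0 y : I y -> s 0 y = 1.
Proof. by move=> Iy; rewrite /s/= indicE mem_set. Qed.

Let sS j y : I y -> ((s j.+1 y)%:E = \int[nu]_x (s j (y + x))%:E)%E.
Proof. by move=> Iy; rewrite -sE surv_in//; apply: eq_integral => x _; rewrite sE. Qed.

(* The caloric polynomial z (4 k^2 - 3 j a2 - z^2) is nonpositive off I up to
   distance k below it; a jump beyond that costs at most x^4 / k. *)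
Lemma surv_strip_lower (N : nat) (k a b : R) : I = `[(- a), b]%classic ->
  0 < k -> 0 < a -> a <= k / 2 -> 2 * k <= a + b -> N%:R * a2 = k ^+ 2 ->
  3 / 32 * (a / k) - N%:R * (a4 / (8 * k ^+ 4)) <= fine (surv nu I N 0).
Proof.
move=> IE k0 a0 ak kab Nk; rewrite -/(s N 0).
have a20 : 0 <= a2.
  by rewrite -lee_fin -nu2; apply: integral_ge0 => x _; rewrite lee_fin sqr_ge0.
(* [c] normalises the polynomial to be at most 1 when no time is left, as z (4 k^2 - z^2) <= 8 k^3
   for z >= 0. *)
pose c := (8 * k ^+ 3)^-1.
have c0 : 0 < c by rewrite invr_gt0 mulr_gt0// exprn_gt0.
have c0' := ltW c0; have k0' := ltW k0.
have k4 : a4 / (8 * k ^+ 4) = c * a4 / k by rewrite /c; field; rewrite gt_eqF.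
rewrite k4.
have a40 : 0 <= a4.
  rewrite -lee_fin -nu4; apply: integral_ge0 => x _.
  by rewrite lee_fin exprn_even_ge0.
have Iin y : I y <-> 0 <= y + a <= a + b.
  by rewrite IE /= in_itv/=; split => /andP[h1 h2]; apply/andP; split; lra.
(* [j] counts the steps left. Since [j] <= [N] and [N] a2 = k^2, the coefficient 4 k^2 - 3 j a2
   stays at least k^2, which gives the sign of the polynomial for -k <= z < 0. *)
have main j y : (j <= N)%N -> - k <= y + a ->
    c * ((y + a) * (4 * k ^+ 2 - 3 * (j%:R * a2) - (y + a) ^+ 2)) -
      j%:R * (c * a4 / k) <= s j y.
  elim: j y => [|j ih] y jN yk.
    rewrite mul0r mulr0 subr0 mul0r subr0; set z := y + a in yk *.
    have [Iy|Iy] := pselect (I y).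
      have /andP[z0 zb] := (Iin y).1 Iy; rewrite -/z in z0 zb.
      rewrite sin0// /c mulrC ler_pdivrMr ?mulr_gt0 ?exprn_gt0// mul1r.
      have [zk|zk] := lerP z (2 * k).
        have h1 : 0 <= (2 * k - z) * z ^+ 2 by rewrite mulr_ge0 ?sqr_ge0// subr_ge0.
        have h2 : 0 <= k * (k - z) ^+ 2 by rewrite mulr_ge0 ?sqr_ge0// ltW.
        rewrite !expr2 !exprS expr0 in h1 h2 *; nra.
      have h1 : 0 <= z * (z ^+ 2 - (2 * k) ^+ 2).
        rewrite mulr_ge0// subr_ge0 ler_sqr ?nnegrE//; first exact: ltW.
        by rewrite mulr_ge0// ltW.
      have h2 : 0 < k ^+ 3 by rewrite exprn_gt0.
      rewrite !exprMn in h1; lra.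
    rewrite sout// pmulr_rle0//.
    have zI : (z < 0) || (a + b < z).
      apply/negPn/negP => /norP[]; rewrite -!leNgt => h1 h2.
      by apply: Iy; apply/Iin; rewrite h1.
    case/orP : zI => zI.
      rewrite nmulr_rle0// subr_ge0 -[4]/(4%:R) (_ : 4 * k ^+ 2 = (2 * k) ^+ 2); last by ring.
      rewrite -real_normK ?num_real// ler_sqr ?nnegrE ?normr_ge0//; last by lra.
      rewrite ler0_norm; lra.
    rewrite pmulr_rle0; last by lra.
    rewrite subr_le0 (_ : 4 * k ^+ 2 = (2 * k) ^+ 2); last by ring.
    by rewrite ler_sqr ?nnegrE; lra.
  set z := y + a in yk *.
  have jN' : (j <= N)%N by exact: ltnW.
  pose K := 4 * k ^+ 2 - 3 * (j%:R * a2).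
  have K2 : k ^+ 2 + 3 * a2 <= K.
    have : j.+1%:R * a2 <= k ^+ 2 by rewrite -Nk ler_wpM2r// ler_nat.
    rewrite -natr1 mulrDl mul1r /K; lra.
  have KE : 4 * k ^+ 2 - 3 * (j.+1%:R * a2) = K - 3 * a2 by rewrite -natr1 /K; ring.
  rewrite KE.
  have e0 : 0 <= c * a4 / k by rewrite divr_ge0 ?mulr_ge0// ltW.
  have [Iy|Iy] := pselect (I y); last first.
    rewrite sout// subr_le0 (@le_trans _ _ 0)//; last by rewrite mulr_ge0.
    rewrite pmulr_rle0//.
    have zI : (z < 0) || (a + b < z).
      apply/negPn/negP => /norP[]; rewrite -!leNgt => h1 h2.
      by apply: Iy; apply/Iin; rewrite h1.
    case/orP : zI => zI.
      rewrite nmulr_rle0// subr_ge0 (@le_trans _ _ (k ^+ 2))//; last by lra.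
      rewrite -real_normK ?num_real// ler_sqr ?nnegrE ?normr_ge0//.
      rewrite ler0_norm; lra.
    rewrite pmulr_rle0; last by lra.
    rewrite subr_le0 (@le_trans _ _ ((2 * k) ^+ 2))//.
      rewrite exprMn /K; have : 0 <= j%:R * a2 by rewrite mulr_ge0.
      lra.
    by rewrite ler_sqr ?nnegrE; lra.
  have /andP[z0 zb] := (Iin y).1 Iy; rewrite -/z in z0 zb.
  have pt x : c * ((z + x) * (K - (z + x) ^+ 2)) - j%:R * (c * a4 / k) -
      c * x ^+ 4 / k <= s j (y + x).
    have x4' : 0 <= x ^+ 4 by rewrite exprn_even_ge0.
    have x4 : 0 <= c * x ^+ 4 / k by rewrite divr_ge0// mulr_ge0.
    have [zx|zx] := lerP (- k) (z + x).
      have := ih (y + x) jN'; rewrite -addrA (addrC x) addrA -/z => /(_ zx).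
      rewrite -/K; lra.
    apply: le_trans (s0 _ _).
    (* With w = z + x < -k the left side is at most c |w|^3 <= c w^4 / k, and |w| <= |x| because z
       >= 0. *)
    suff : c * ((z + x) * (K - (z + x) ^+ 2)) <= c * x ^+ 4 / k.
      have : 0 <= j%:R * (c * a4 / k) by rewrite mulr_ge0.
      lra.
    rewrite -mulrA ler_pM2l// ler_pdivlMr//.
    set w := z + x in zx *.
    have wx : x <= w by rewrite /w lerDr.
    have w4 : w ^+ 4 <= x ^+ 4.
      rewrite -[w ^+ 4]/(w ^+ (2 * 2)) -[x ^+ 4]/(x ^+ (2 * 2)) !exprM.
      rewrite ler_sqr ?nnegrE ?sqr_ge0// -subr_ge0.
      rewrite (_ : _ - _ = (w - x) * (- w - x)); last by ring.
      by rewrite mulr_ge0//; lra.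
    apply: le_trans w4.
    have h1 : 0 <= w ^+ 2 by exact: sqr_ge0.
    have h2 : w * K <= 0.
      rewrite nmulr_rle0; last by lra.
      by rewrite (le_trans _ K2)// addr_ge0 ?sqr_ge0// mulr_ge0.
    have h3 : w * K * k <= 0 by rewrite mulr_le0_ge0// ltW.
    have h4 : 0 <= w ^+ 2 * w * (w + k).
      by rewrite -mulrA mulr_ge0// mulr_le0//; lra.
    rewrite (_ : w * (K - w ^+ 2) * k = w * K * k - w ^+ 2 * w * k); last by ring.
    rewrite (_ : w ^+ 4 = w ^+ 2 * w * (w + k) - w ^+ 2 * w * k); last by ring.
    lra.
  have := @sym_integral_ge (s j) y (6 * c * z) (2 * c / k)
    (c * (z * (K - z ^+ 2)) - j%:R * (c * a4 / k)) (ms j) (s0 j).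
  rewrite -sS// -EFinD lee_fin => h'.
  have {}h' : c * (z * (K - z ^+ 2)) - j%:R * (c * a4 / k) <=
      s j.+1 y + (6 * c * z * a2 + 2 * c / k * a4) / 2.
    apply: h' => [||x].
    - by rewrite !mulr_ge0// ltW.
    - by rewrite divr_ge0 ?mulr_ge0// ltW.
    have p1 := pt x; have p2 := pt (- x).
    rewrite (_ : (- x) ^+ 4 = x ^+ 4) in p2; last by ring.
    (* Half of the second difference is -3 c z x^2. Its integral -3 c z a2 is exactly the effect of
       replacing [K] by [K - 3 a2], so the polynomial is caloric up to the overshoot term. *)
    have E : c * ((z + x) * (K - (z + x) ^+ 2)) + c * ((z + - x) * (K - (z + - x) ^+ 2))
      = 2 * (c * (z * (K - z ^+ 2))) - 6 * c * z * x ^+ 2 by ring.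
    have E2 : 2 * c / k * x ^+ 4 = 2 * (c * x ^+ 4 / k) by ring.
    rewrite E2; lra.
  have E3 : (6 * c * z * a2 + 2 * c / k * a4) / 2 = c * (z * (3 * a2)) + c * a4 / k.
    by field; rewrite gt_eqF.
  rewrite E3 in h'.
  have E4 : c * (z * (K - 3 * a2 - z ^+ 2)) = c * (z * (K - z ^+ 2)) - c * (z * (3 * a2)).
    by ring.
  rewrite E4 -(natr1 j) (mulrDl j%:R) mul1r; lra.
have := main N 0 (leqnn N); rewrite add0r Nk => /(_ _)-h.
apply: le_trans (h _); last by lra.
rewrite lerD2r.
(* At the start the polynomial is c a (k^2 - a^2), and a <= k / 2 bounds the bracket below by 3/4
   k^2. *)
have -> : 3 / 32 * (a / k) = c * (a * (3 / 4 * k ^+ 2)).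
  by rewrite /c; field; rewrite gt_eqF.
rewrite ler_pM2l// ler_pM2l//.
have : a ^+ 2 <= (k / 2) ^+ 2 by rewrite ler_sqr ?nnegrE; lra.
by rewrite expr_div_n; lra.
Qed.

(* With q = (y + 2a) / k, the polynomial q (4 - q) exceeds 1 on [1, 3] and loses
   a2 / k^2 = 1 / N at each step started below 1. *)
Lemma surv_halfline_upper (N : nat) (k a : R) : I = `[(- a), +oo[%classic ->
  0 < k -> 0 < a -> (0 < N)%N -> N%:R * a2 = k ^+ 2 ->
  fine (surv nu I N 0) <= 8 * (a / k) + N%:R * (5 * a4 / (k ^+ 4 * (a / k) ^+ 3)).
Proof.
move=> IE k0 a0 N0 Nk; rewrite -/(s N 0).
have a40 : 0 <= a4.
  rewrite -lee_fin -nu4; apply: integral_ge0 => x _.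
  by rewrite lee_fin exprn_even_ge0.
set dl := a / k.
have dl0 : 0 < dl by exact: divr_gt0.
have dl3 : 0 < dl ^+ 3 by exact: exprn_gt0.
have k4 : 0 < k ^+ 4 by exact: exprn_gt0.
set e := 5 * a4 / (k ^+ 4 * dl ^+ 3).
have e0 : 0 <= e by apply: divr_ge0; [lra|rewrite mulr_ge0 ?ltW].
have Ne0 (j : nat) : 0 <= j%:R * e by exact: mulr_ge0.
have [dl1|dl1] := ltP 1 dl.
  by have := s1 N 0; have := Ne0 N; lra.
have Nn0 : 0 < N%:R :> R by rewrite ltr0n.
have Iin y : I y <-> - a <= y by rewrite IE /= in_itv/= andbT.
(* In the variable q the half-line begins at [dl] and the walk at [2 * dl]. The shift by 2a instead
   of a leaves a buffer: from q >= [dl], a step w into q + w < 0, where the polynomial is negative,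
   has |w| > [dl], and w^4 / dl^3 pays for it. The term 1 - j / N makes the bound trivial at j = 0
   and vanishes at j = [N]. *)
have main j q : (j <= N)%N -> 0 <= q -> q <= 3 ->
    s j (k * q - 2 * a) <= q * (4 - q) + (1 - j%:R / N%:R) + j%:R * e.
  elim: j q => [|j ih] q jN q0 q3.
    have : 0 <= q * (4 - q) by rewrite mulr_ge0//; lra.
    by have := s1 0%N (k * q - 2 * a); rewrite !mul0r; lra.
  have jN1 : j.+1%:R / N%:R <= 1 :> R by rewrite ler_pdivrMr// mul1r ler_nat.
  have q4 : 0 <= q * (4 - q) by rewrite mulr_ge0//; lra.
  have [Iy|Iy] := pselect (I (k * q - 2 * a)); last first.
    by rewrite sout//; have := Ne0 j.+1; lra.
  have [q1|q1] := lerP 1 q.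
    have : 0 <= (q - 1) * (3 - q) by rewrite mulr_ge0//; lra.
    by have := s1 j.+1 (k * q - 2 * a); have := Ne0 j.+1; lra.
  have qdl : dl <= q.
    by have := (Iin _).1 Iy; rewrite /dl ler_pdivrMr// mulrC; lra.
  have jN' : (j <= N)%N by exact: ltnW.
  have jN1' : 0 <= 1 - j%:R / N%:R :> R.
    by rewrite subr_ge0 ler_pdivrMr// mul1r ler_nat.
  have pt w : s j (k * q - 2 * a + k * w) <=
      (q + w) * (4 - (q + w)) + (1 - j%:R / N%:R) + j%:R * e + 5 * w ^+ 4 / dl ^+ 3.
    have w4 : 0 <= w ^+ 4 by rewrite exprn_even_ge0.
    have w2 : 0 <= w ^+ 2 by rewrite sqr_ge0.
    have dl31 : dl ^+ 3 <= 1 by rewrite exprn_ile1// ltW.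
    have w5 : 5 * w ^+ 4 <= 5 * w ^+ 4 / dl ^+ 3.
      by rewrite ler_pdivlMr// ler_piMr// mulr_ge0.
    rewrite (_ : k * q - 2 * a + k * w = k * (q + w) - 2 * a); last by ring.
    have [qw0|qw0] := ltP (q + w) 0.
      rewrite sout; last first.
        have : k * (q + w) <= 0 by rewrite pmulr_rle0// ltW.
        by move=> h /Iin; lra.
      suff : - ((q + w) * (4 - (q + w))) <= 5 * w ^+ 4 / dl ^+ 3.
        by have := Ne0 j; lra.
      rewrite ler_pdivlMr//.
      set W := - w.
      have W1 : dl <= W by rewrite /W; lra.
      have W0 : 0 < W by exact: lt_le_trans W1.
      have -> : w = - W by rewrite opprK.
      have -> : 5 * (- W) ^+ 4 = (W * 4) * W ^+ 3 + W ^+ 2 * W ^+ 2 by ring.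
      have W3 : dl ^+ 3 <= W ^+ 3 by rewrite lerXn2r ?nnegrE// ltW.
      have W2 : dl ^+ 2 <= W ^+ 2 by rewrite lerXn2r ?nnegrE// ltW.
      have W3' : dl ^+ 3 <= W ^+ 2.
        by apply: le_trans W2; rewrite exprSr ler_piMr// sqr_ge0.
      apply: (@le_trans _ _ ((W * 4 + W ^+ 2) * dl ^+ 3)).
        rewrite ler_pM2r//.
        have : 0 <= q * (W + (W - q) + 4) by rewrite mulr_ge0//; lra.
        by rewrite expr2; lra.
      rewrite mulrDl lerD// ler_wpM2l ?sqr_ge0//.
      by rewrite mulr_ge0// ltW.
    have [qw3|qw3] := lerP (q + w) 3.
      by apply: le_trans (ih (q + w) jN' qw0 qw3) _; rewrite lerDl; lra.
    (* From q < 1, passing 3 takes a step larger than 2, so the negative part (q + w - 2)^2 is at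
       most w^2 <= w^4. *)
    have ww : 2 < w by lra.
    have : 4 <= w ^+ 2 by rewrite -[4]/(4%:R) (_ : 4%:R = 2 ^+ 2) ?ler_sqr ?nnegrE; [lra..|ring].
    move=> w24.
    have w42 : w ^+ 2 <= w ^+ 4.
      rewrite -[w ^+ 4]/(w ^+ (2 + 2)) exprD ler_peMr//; lra.
    have : (q + w - 2) ^+ 2 <= w ^+ 2 by rewrite ler_sqr ?nnegrE; lra.
    have := s1 j (k * (q + w) - 2 * a); have := Ne0 j.
    have -> : (q + w) * (4 - (q + w)) = 4 - (q + w - 2) ^+ 2 by ring.
    lra.
  have k2 : 0 < k ^+ 2 by exact: exprn_gt0.
  have := @sym_integral_le (s j) (k * q - 2 * a) (2 / k ^+ 2)
    (10 / (k ^+ 4 * dl ^+ 3)) (q * (4 - q) + (1 - j%:R / N%:R) + j%:R * e) (ms j) (s0 j).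
  rewrite -sS// -EFinD lee_fin => h.
  have {}h : s j.+1 (k * q - 2 * a) + 2 / k ^+ 2 * a2 / 2 <=
     q * (4 - q) + (1 - j%:R / N%:R) + j%:R * e + 10 / (k ^+ 4 * dl ^+ 3) * a4 / 2.
    apply: h => [||x].
    - by rewrite divr_ge0// ltW.
    - by rewrite divr_ge0// mulr_ge0// ltW.
    have p1 := pt (x / k); have p2 := pt (- (x / k)).
    rewrite mulrN in p2.
    rewrite (_ : k * (x / k) = x) in p1 p2; last by field; rewrite gt_eqF.
    rewrite (_ : (- (x / k)) ^+ 4 = (x / k) ^+ 4) in p2; last by ring.
    have E1 : 10 / (k ^+ 4 * dl ^+ 3) * x ^+ 4 = 2 * (5 * (x / k) ^+ 4 / dl ^+ 3).
      by field; rewrite !gt_eqF.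
    have E2 : 2 / k ^+ 2 * x ^+ 2 = 2 * (x / k) ^+ 2 by field; rewrite gt_eqF.
    rewrite E1 E2.
    have E3 : (q + x / k) * (4 - (q + x / k)) + (q - x / k) * (4 - (q - x / k)) =
      2 * (q * (4 - q)) - 2 * (x / k) ^+ 2 by ring.
    lra.
  have E4 : 2 / k ^+ 2 * a2 / 2 = 1 / N%:R.
    by rewrite -Nk; field; rewrite gt_eqF//= gt_eqF// -(pmulr_rgt0 _ Nn0) Nk.
  have E5 : 10 / (k ^+ 4 * dl ^+ 3) * a4 / 2 = e.
    by rewrite /e; field; rewrite !gt_eqF.
  rewrite E4 E5 in h.
  rewrite -(natr1 j) (mulrDl j%:R 1 e) (mulrDl j%:R 1) mul1r; lra.
have := main N (2 * dl) (leqnn N); rewrite divff ?gt_eqF// subrr addr0.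
rewrite (_ : k * (2 * dl) - 2 * a = 0); last by rewrite /dl; field; rewrite gt_eqF.
move=> h.
apply: (le_trans (h _ _)); [lra| lra|].
have : 0 <= dl ^+ 2 by exact: sqr_ge0.
by rewrite lerD2r expr2; lra.
Qed.

End with_set.
End symmetric_moments.

(** * Gaussian moments *)

Section gaussian.
Context (R : realType).
Local Notation mu := (@lebesgue_measure R).
Local Notation N01 s := (@normal_prob R 0 s).

(** The Radon-Nikodym derivative of [normal_prob] has the same integral as [normal_pdf] over every
    measurable set, so the two agree almost everywhere. *)
Lemma ge0_integral_normal (s : R) (f : R -> \bar R) : measurable_fun setT f ->
  (forall x, (0 <= f x)%E) ->
  (\int[N01 s]_x f x = \int[mu]_x (f x * (normal_pdf 0 s x)%:E))%E.
Proof.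
move=> mf f0.
have dom := @normal_prob_dominates R 0 s.
rewrite -(Radon_Nikodym_SigmaFinite.change_of_variables dom)//.
have fi := Radon_Nikodym_SigmaFinite.f_integrable dom.
apply: ae_eq_integral => //.
- by apply: emeasurable_funM => //; exact: measurable_int fi.
- apply: emeasurable_funM => //; apply/measurable_EFinP.
  exact: measurable_normal_pdf.
- apply: ae_eqe_mul2l; apply: integral_ae_eq => //.
    by apply/measurable_EFinP; exact: measurable_normal_pdf.
  by move=> E _ mE; rewrite -Radon_Nikodym_SigmaFinite.f_integral.
Qed.

Lemma normal_symmetric (s : R) (f : R -> \bar R) : s != 0 ->
  measurable_fun setT f -> (forall x, (0 <= f x)%E) ->
  (\int[N01 s]_x f (- x)%R = \int[N01 s]_x f x)%E.
Proof.
move=> s0 mf f0.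
have pdfN x : normal_pdf 0 s (- x) = normal_pdf 0 s x.
  by rewrite !normal_pdfE// /normal_fun !subr0 sqrrN.
rewrite !ge0_integral_normal//; last exact: measurableT_comp.
pose g x := (f x * (normal_pdf 0 s x)%:E)%E.
have mg : measurable_fun setT g.
  apply: emeasurable_funM => //; apply/measurable_EFinP.
  exact: measurable_normal_pdf.
transitivity (\int[mu]_x g (- x)%R)%E.
  by apply: eq_integral => x _; rewrite /g pdfN.
have := @ge0_integral_pushforward _ _ (measurableTypeR R) (measurableTypeR R) R
  -%R (@oppr_measurable R setT) mu setT g measurableT mg.
move=> /(_ _)/= <-.
  by apply: eq_measure_integral => A mA _; exact: lebesgue_measureN.
by move=> x _; rewrite /g mule_ge0// lee_fin normal_pdf_ge0.
Qed.

Lemma normal_scale (s : R) n : 0 < s -> ~~ odd n ->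
  (\int[N01 s]_x (x ^+ n)%:E = (s ^+ n)%:E * \int[N01 1]_x (x ^+ n)%:E)%E.
Proof.
move=> s0 on.
have mX : measurable_fun setT (fun x : R => (x ^+ n)%:E).
  by apply/measurable_EFinP; exact: measurable_funX.
have X0 (x : R) : (0 <= (x ^+ n)%:E)%E by rewrite lee_fin exprn_even_ge0.
rewrite !ge0_integral_normal//.
pose F (x : R) := s * x.
have F' : F^`()%classic = cst s.
  apply/funext => x; rewrite /F derive1E deriveM// derive_cst scaler0 addr0.
  by rewrite derive_id; exact: mulr1.
pose G (x : R) := x ^+ n * normal_pdf 0 s x.
under eq_integral do rewrite -EFinM -/(G _).
rewrite (increasing_ge0_integration_by_substitutionT (F := F)).
- rewrite -ge0_integralZl_EFin//.
  + apply: eq_integral => x _; rewrite F' /G/= -!EFinM; congr EFin.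
    rewrite -[LHS]/(F x ^+ n * normal_pdf 0 s (F x) * s).
    rewrite !normal_pdfE ?gt_eqF// /F /normal_fun !subr0 exprMn.
    have -> : - (s * x) ^+ 2 / (s ^+ 2 *+ 2) = - x ^+ 2 / (1 ^+ 2 *+ 2).
      by rewrite exprMn expr1n -(mulr_natr (s ^+ 2) 2) -mulrN -mulf_div divff ?expf_neq0 ?gt_eqF// mul1r.
    have -> : @normal_peak R s = normal_peak 1 / s.
      rewrite /normal_peak -!mulrnAr sqrtrM ?sqr_ge0// sqrtr_sqr gtr0_norm//.
      by rewrite expr1n mul1r invfM mulrC.
    by field; rewrite gt_eqF.
  + by move=> x _; rewrite mule_ge0// lee_fin normal_pdf_ge0.
  + apply: emeasurable_funM => //; apply/measurable_EFinP.
    exact: measurable_normal_pdf.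
  + exact/ltW/exprn_gt0.
- by move=> x y xy; rewrite /F ltr_pM2l.
- by rewrite F' => ?; exact: cvg_cst.
- by rewrite F'; exact: is_cvg_cst.
- by rewrite F'; exact: is_cvg_cst.
- by move=> x; exact: derivableM.
- by apply/gt0_cvgMrNy => //; exact: cvg_id.
- by apply/gt0_cvgMry => //; exact: cvg_id.
- move=> x; apply: cvgM; first exact: exprn_continuous.
  by apply: continuous_normal_pdf; rewrite gt_eqF.
- by move=> x; rewrite /G mulr_ge0 ?normal_pdf_ge0// exprn_even_ge0.
Qed.

(** The density is at most its peak 1 / (s sqrt (2 pi)), which is below 1 / s. *)
Lemma normal_small_ball (s b : R) : 0 < s -> 0 <= b ->
  (N01 s `[(- b)%R, b]%classic <= (2 * b / s)%:E)%E.
Proof.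
move=> s0 b0; rewrite /normal_prob.
apply: (@le_trans _ _ (\int[mu]_(x in `[(- b)%R, b]) (s^-1)%:E)%E).
  apply: ge0_le_integral => //.
  - by move=> x _; rewrite lee_fin normal_pdf_ge0.
  - by apply/measurable_EFinP/measurable_funTS; exact: measurable_normal_pdf.
  - move=> x _; rewrite lee_fin (le_trans (normal_pdf_ub _ _ _)) ?gt_eqF//.
    rewrite /normal_peak lef_pV2 ?posrE ?sqrtr_gt0//; last first.
      by rewrite mulrn_wgt0// mulr_gt0 ?pi_gt0// exprn_gt0.
    rewrite -[leLHS]gtr0_norm// -sqrtr_sqr ler_wsqrtr// -mulrnAr ler_peMr ?sqr_ge0//.
    have := pi_ge2 R; rewrite mulr2n; lra.
rewrite integral_cst//= lebesgue_measure_itv/= lte_fin.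
case: ifPn => bb; last first.
  by rewrite mule0 lee_fin divr_ge0 ?mulr_ge0// ltW.
rewrite -EFinD -EFinM lee_fin opprK (_ : s^-1 * (b + b) = 2 * b / s)//.
by field; rewrite gt_eqF.
Qed.

(** The moments stay abstract constants: the walk estimates use the scaling in s, a positive second
    moment and a finite fourth one. *)
Lemma normal_moments : exists m2 m4 : R, 0 < m2 /\ 0 <= m4 /\ forall s : R, 0 < s ->
  (\int[N01 s]_x (x ^+ 2)%:E = (m2 * s ^+ 2)%:E)%E /\
  (\int[N01 s]_x (x ^+ 4)%:E = (m4 * s ^+ 4)%:E)%E.
Proof.
have mX n : measurable_fun setT (fun x : R => (x ^+ n)%:E).
  by apply/measurable_EFinP; exact: measurable_funX.
have X0 n (x : R) : ~~ odd n -> (0 <= (x ^+ n)%:E)%E.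
  by move=> on; rewrite lee_fin exprn_even_ge0.
have I0 n : ~~ odd n -> (0 <= \int[N01 1]_x (x ^+ n)%:E)%E.
  by move=> on; apply: integral_ge0 => x _; exact: X0.
have I4 : (\int[N01 1]_x (x ^+ 4)%:E < +oo)%E.
  (* The integrand is dominated by a multiple of the Gaussian density of variance 2: with u = x^2 /
     8, half of the exponent absorbs x^4 = 64 u^2 through u^2 <= exp (2 u). *)
  pose r : R := Num.sqrt 2.
  have r0 : 0 < r by rewrite sqrtr_gt0.
  have r2 : r ^+ 2 = 2 by rewrite sqr_sqrtr.
  pose c := 64 * normal_peak 1 / normal_peak r.
  have c0 : 0 <= c by rewrite divr_ge0 ?mulr_ge0 ?normal_peak_ge0.
  rewrite ge0_integral_normal//; last by move=> x; exact: X0.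
  rewrite (@le_lt_trans _ _ (\int[mu]_x (c%:E * (normal_pdf 0 r x)%:E))%E)//; last first.
    rewrite ge0_integralZl_EFin//; first by rewrite integral_normal_pdf mule1 ltry.
    - by move=> x _; rewrite lee_fin normal_pdf_ge0.
    - by apply/measurable_EFinP; exact: measurable_normal_pdf.
  apply: ge0_le_integral => //.
  - by move=> x _; rewrite mule_ge0 ?X0// lee_fin normal_pdf_ge0.
  - apply: emeasurable_funM; first exact: mX.
    apply/measurable_EFinP.
    exact: measurable_normal_pdf.
  - apply: emeasurable_funM => //; apply/measurable_EFinP.
    exact: measurable_normal_pdf.
  - move=> x _; rewrite -!EFinM lee_fin !normal_pdfE ?gt_eqF//.
    rewrite /normal_fun !subr0 r2 expr1n.
    set u : R := x ^+ 2 / 8.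
    have u0 : 0 <= u by rewrite divr_ge0 ?sqr_ge0.
    have -> : - x ^+ 2 / (1 *+ 2) = - (4 * u) :> R by rewrite mulr2n /u; field.
    have -> : - x ^+ 2 / (2 *+ 2) = - (2 * u) :> R by rewrite mulr2n /u; field.
    have -> : x ^+ 4 = 64 * u ^+ 2 by rewrite /u; field.
    rewrite (_ : - (4 * u) = - (2 * u) + - (2 * u)); last by ring.
    rewrite expRD /c.
    have p1 := @normal_peak_gt0 R 1 (oner_neq0 _).
    have pr := @normal_peak_gt0 R r (lt0r_neq0 r0).
    rewrite (_ : 64 * normal_peak 1 / normal_peak r * (normal_peak r * expR (- (2 * u)))
      = 64 * normal_peak 1 * expR (- (2 * u))); last by field; rewrite gt_eqF.
    rewrite (_ : 64 * u ^+ 2 * (normal_peak 1 * (expR (- (2 * u)) * expR (- (2 * u)))) =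
      (64 * normal_peak 1 * expR (- (2 * u))) * (u ^+ 2 * expR (- (2 * u)))); last by ring.
    rewrite ler_piMr//; first by rewrite !mulr_ge0 ?expR_ge0// ltW.
    rewrite expRN ler_pdivrMr ?expR_gt0// mul1r.
    rewrite (_ : 2 * u = u + u) ?expRD; last by ring.
    have : u <= expR u by have := expR_ge1Dx u; lra.
    by move=> h; rewrite expr2 ler_pM.
have I2 : (\int[N01 1]_x (x ^+ 2)%:E < +oo)%E.
  rewrite (@le_lt_trans _ _ (\int[N01 1]_x (1%:E + (x ^+ 4)%:E))%E)//.
    apply: ge0_le_integral => //.
    - by move=> x _; exact: X0.
    - exact: mX.
    - by apply: emeasurable_funD => //; exact: mX.
    - move=> x _; rewrite -EFinD lee_fin.
      by have := sqr_ge0 (x ^+ 2 - 1); have := sqr_ge0 (x ^+ 2); rewrite !expr2; lra.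
  rewrite ge0_integralD//; [|by move=> x _; exact: X0|exact: mX].
  rewrite integral_cst//= mul1e lte_add_pinfty//.
  by rewrite (le_lt_trans (probability_le1 (normal_prob 0 1) measurableT)) ?ltry.
exists (fine (\int[N01 1]_x (x ^+ 2)%:E)%E), (fine (\int[N01 1]_x (x ^+ 4)%:E)%E).
split; [|split].
- rewrite fine_gt0// I2 andbT.
  (* Markov's inequality at level 1/16: by [normal_small_ball] the interval [-1/4, 1/4] has mass at
     most 1/2, so |x| >= 1/4 has positive probability. *)
  have := @le_integral_abse _ _ _ (normal_prob 0 1) setT measurableT _ (16^-1) (mX 2%N).
  rewrite setTI => /(_ ltac:(by []))h.
  have h2 : (\int[N01 1]_x `|(x ^+ 2)%:E| = \int[N01 1]_x (x ^+ 2)%:E)%E.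
    by apply: eq_integral => x _; rewrite gee0_abs// X0.
  rewrite h2 in h; apply: lt_le_trans h.
  rewrite mule_gt0 ?lte_fin//.
  set A := [set x : R | _].
  have mA : measurable A.
    rewrite /A -[X in measurable X]setTI.
    apply: emeasurable_fun_c_infty => //.
    exact: measurableT_comp.
  rewrite lt0e measure_ge0 andbT; apply/eqP => A0.
  have := probability_setC (normal_prob 0 1) mA.
  rewrite A0 sube0 => AC.
  have : (N01 1 (~` A) <= N01 1 `[(- 4^-1)%R, 4^-1%R]%classic)%E.
    apply: le_measure; rewrite ?inE//; first exact: measurableC.
    move=> x /= /negP; rewrite -ltNge lte_fin normrX.
    rewrite (_ : 16^-1 = 4^-1 ^+ 2 :> R) ?ltr_sqr ?nnegrE//; last by field.
    by move=> /ltW; rewrite ler_norml in_itv.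
  rewrite AC => h1; have := le_trans h1 (@normal_small_ball 1 4^-1 ltr01 _).
  by rewrite lee_fin => /(_ _); lra.
- by rewrite fine_ge0// I0.
- have finE n : ~~ odd n -> (\int[N01 1]_x (x ^+ n)%:E < +oo)%E ->
      (\int[N01 1]_x (x ^+ n)%:E = (fine (\int[N01 1]_x (x ^+ n)%:E))%:E)%E.
    by move=> on In; rewrite fineK// ge0_fin_numE// I0.
  move=> s s0; split.
  + by rewrite (normal_scale (n := 2) s0)// [in LHS]finE// -EFinM [in LHS]mulrC.
  + by rewrite (normal_scale (n := 4) s0)// [in LHS]finE// -EFinM [in LHS]mulrC.
Qed.

(* normal_prob lives on measurableTypeR, whose display differs from that of R. *)
Let idR : measurableTypeR R -> R := id.

Let midR : measurable_fun setT idR.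
Proof. by move=> _ A mA; rewrite setTI. Qed.

Let midR_mixin := isMeasurableFun.Build _ _ _ _ idR midR.
Let midR_pack : {mfun measurableTypeR R >-> R} := HB.pack idR midR_mixin.

Definition gauss (s : R) : probability R R := distribution (N01 s) midR_pack.

Lemma ge0_integral_gauss s (f : R -> \bar R) : measurable_fun setT f ->
  (forall x, (0 <= f x)%E) -> (\int[gauss s]_x f x = \int[N01 s]_x f x)%E.
Proof. by move=> mf f0; rewrite ge0_integral_distribution. Qed.

Lemma gauss_symmetric (s : R) (f : R -> \bar R) : s != 0 ->
  measurable_fun setT f -> (forall x, (0 <= f x)%E) ->
  (\int[gauss s]_x f (- x)%R = \int[gauss s]_x f x)%E.
Proof.
move=> s0 mf f0; rewrite !ge0_integral_gauss//; first exact: normal_symmetric.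
exact: measurableT_comp.
Qed.

Lemma gauss_moments : exists m2 m4 : R, 0 < m2 /\ 0 <= m4 /\ forall s : R, 0 < s ->
  (\int[gauss s]_x (x ^+ 2)%:E = (m2 * s ^+ 2)%:E)%E /\
  (\int[gauss s]_x (x ^+ 4)%:E = (m4 * s ^+ 4)%:E)%E.
Proof.
have [m2 [m4 [m20 [m40 h]]]] := normal_moments.
exists m2, m4; split=> //; split=> // s /h[h2 h4].
split; [rewrite -h2|rewrite -h4]; apply: ge0_integral_gauss.
- by apply/measurable_EFinP; exact: measurable_funX.
- by move=> x; rewrite lee_fin exprn_even_ge0.
- by apply/measurable_EFinP; exact: measurable_funX.
- by move=> x; rewrite lee_fin exprn_even_ge0.
Qed.
End gaussian.

(** * Brownian estimates *)

(* N steps of length s / N on [0, s], followed by n steps of length s / n. *)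
Definition grid (R : realType) (s : R) (N n k : nat) : R :=
  if (k <= N)%N then k%:R * (s / N%:R) else s + (k - N)%:R * (s / n%:R).

Section grid_theory.
Context (R : realType) (s : R) (N n : nat).
Hypotheses (s0 : 0 < s) (N0 : (0 < N)%N) (n0 : (0 < n)%N).

Let NR : N%:R != 0 :> R. Proof. by rewrite pnatr_eq0 -lt0n. Qed.
Let nR : n%:R != 0 :> R. Proof. by rewrite pnatr_eq0 -lt0n. Qed.

Lemma grid0 : grid s N n 0 = 0.
Proof. by rewrite /grid leq0n mul0r. Qed.

Lemma grid_stepl k : (k < N)%N -> grid s N n k.+1 - grid s N n k = s / N%:R.
Proof. by move=> kN; rewrite /grid kN ltnW// -natr1 mulrDl mul1r addrC addKr. Qed.

Lemma grid_stepr l : grid s N n (N + l).+1 - grid s N n (N + l) = s / n%:R.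
Proof.
rewrite /grid ltnNge leq_addr/= subSn ?leq_addr// addKn.
case: l => [|l].
  by rewrite addn0 leqnn mul1r; field; apply/andP.
rewrite leqNgt addnS ltnS leq_addr/= -(natr1 l.+1) mulrDl mul1r; ring.
Qed.

Lemma grid_incr k : grid s N n k < grid s N n k.+1.
Proof.
rewrite -subr_gt0; have [kN|kN] := ltnP k N.
  by rewrite grid_stepl// divr_gt0// ltr0n.
by rewrite -(subnKC kN) grid_stepr divr_gt0// ltr0n.
Qed.

Lemma grid_ge0 k : 0 <= grid s N n k.
Proof.
elim: k => [|k ih]; first by rewrite grid0.
by rewrite (le_trans ih)// ltW// grid_incr.
Qed.

Lemma grid_le k : (k <= N + n)%N -> grid s N n k <= 2 * s.
Proof.
move=> kNn; rewrite /grid; case: leqP => kN.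
  have : k%:R / N%:R <= 1 :> R by rewrite ler_pdivrMr ?ltr0n// mul1r ler_nat.
  move=> h; rewrite mulrCA; have := ler_wpM2l (ltW s0) h.
  by rewrite mulr1 => /le_trans; apply; have s1 := ltW s0; lra.
have : (k - N)%:R / n%:R <= 1 :> R.
  by rewrite ler_pdivrMr ?ltr0n// mul1r ler_nat leq_subLR.
move=> h; rewrite mulrCA; have := ler_wpM2l (ltW s0) h; rewrite mulr1.
by move: (_ * (_ / _)) => x; have s1 := s0; lra.
Qed.
End grid_theory.

Section brownian.
Context (R : realType).

(** [None] stands for an endpoint beyond the scale of the time horizon: it imposes no constraint and
    counts as the factor 1 in [scaled]. *)
Definition lowset (ba : option R) : set R :=
  if ba is Some a then `[(- a), +oo[%classic else setT.

(** Two points of (-a, b) differ by less than a + b, which is at most 2b when a <= b; hence the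
    factor 2. *)
Definition blockset (bb : option R) : set R :=
  if bb is Some b then `[(- (2 * b)), 2 * b]%classic else setT.

Lemma measurable_lowset ba : measurable (lowset ba).
Proof. by case: ba => [a|]//=. Qed.

Lemma measurable_blockset bb : measurable (blockset bb).
Proof. by case: bb => [b|]//=. Qed.

Definition confined d (T : measurableType d) (Y : R -> T -> R) (s : R) (N n : nat)
    (ba bb : option R) : set T :=
  stays (fun k => Y (grid s N n k)) (lowset ba) N.+1 `&`
  \bigcap_(l in `I_n) [set w | blockset bb
    (Y (grid s N n (N + l).+1) w - Y (grid s N n (N + l)) w)].

Definition scaled (C s : R) (ba : option R) : R :=
  if ba is Some a then C * (a / Num.sqrt s) else 1.

Lemma brownian_boxP d (T : measurableType d) (P : probability T R)
    (Y : R -> T -> R) (t : nat -> R) :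
  brownian_motion P Y -> t 0%N = 0 -> (forall k, t k < t k.+1) ->
  forall n (B : nat -> set R), (forall k, measurable (B k)) ->
  P (\bigcap_(k in `I_n) [set w | B k (Y (t k.+1) w - Y (t k) w)]) =
  \big[*%E/1%E]_(k < n) normal_prob 0 (Num.sqrt (t k.+1 - t k)) (B k).
Proof. by move=> [_ [_ [_ h]]] t0 tS n B mB; apply: h. Qed.

Lemma normal_prob_opp (s : R) (B : set R) : s != 0 -> measurable B ->
  normal_prob 0 s [set x | B (- x)] = normal_prob 0 s B.
Proof.
move=> s0 mB.
have mB' : measurable [set x | B (- x)].
  by rewrite -[X in measurable X]setTI; exact: (@oppr_measurable R setT).
have BE : (\int[normal_prob 0 s]_x (\1_B x)%:E = normal_prob 0 s B)%E.
  by rewrite integral_indic// setIT.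
rewrite -BE -(@normal_symmetric R s (fun x => (\1_B x)%:E))//; last first.
  exact/measurable_EFinP/measurable_indic.
have -> : (\int[normal_prob 0 s]_x (\1_B (- x)%R)%:E =
           \int[normal_prob 0 s]_x (\1_[set x | B (- x)%R] x)%:E)%E.
  by apply: eq_integral => x _; rewrite !indicE.
by rewrite integral_indic// setIT.
Qed.

(** Reflection exchanges the two endpoints, so the smaller one can always serve as the lower
    barrier. *)
Lemma brownian_opp d (T : measurableType d) (P : probability T R)
    (Y : R -> T -> R) :
  brownian_motion P Y -> brownian_motion P (fun s w => - Y s w).
Proof.
move=> [mY [Y0 [cY h]]]; split; first by move=> s; exact: measurableT_comp.
split; first by move=> w; rewrite Y0 oppr0.
split; first by move=> w x; apply: cvgN; exact: cY.
move=> n t B t0 tS mB.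
have := h n t (fun k => [set x | B k (- x)]) t0 tS.
move=> /(_ _)-h'.
rewrite -[RHS](_ : \big[*%E/1%E]_(k < n) normal_prob 0 (Num.sqrt (t k.+1 - t k))
    [set x | B k (- x)] = _); last first.
  apply: eq_bigr => k _; apply: normal_prob_opp; last exact: mB.
  by rewrite gt_eqF// sqrtr_gt0 subr_gt0 tS.
rewrite -h'.
  by congr (P _); apply/seteqP; split=> w /= wB k kn; move: (wB k kn) => /=;
    rewrite opprB opprK addrC.
move=> k kn; rewrite -[X in measurable X]setTI.
by apply: (@oppr_measurable R setT) => //; exact: mB.
Qed.

(** [C] depends on [n] alone, while [N] may depend on the time and the levels: the grid is refined
    until the overshoot error falls below the main term. *)
Lemma confined_le (n : nat) : (0 < n)%N -> exists2 C : R, 0 < C &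
  forall d (T : measurableType d) (P : probability T R) (Y : R -> T -> R),
  brownian_motion P Y -> forall (s : R) (ba bb : option R), 0 < s ->
  (forall a, ba = Some a -> 0 < a) -> (forall b, bb = Some b -> 0 < b) ->
  exists2 N, (0 < N)%N &
    (P (confined Y s N n ba bb) <= (scaled C s ba * scaled C s bb ^+ n)%:E)%E.
Proof.
move=> n0; have [m2 [m4 [m20 [m40 mom]]]] := gauss_moments R.
(* 9 is the 8 of [surv_halfline_upper] plus 1 for the overshoot error; 4 sqrt n is the small-ball
   bound at radius 2b for an increment over time s / n. *)
pose C1 := 9 / Num.sqrt m2; pose C2 := 4 * Num.sqrt n%:R : R.
have sm2 : 0 < Num.sqrt m2 by rewrite sqrtr_gt0.
have C10 : 0 < C1 by rewrite divr_gt0.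
have C20 : 0 < C2 by rewrite mulr_gt0// sqrtr_gt0 ltr0n.
exists (C1 + C2); first exact: addr_gt0.
move=> d T P Y BY s ba bb s0 ba0 bb0.
have ss0 : 0 < Num.sqrt s by rewrite sqrtr_gt0.
pose k := Num.sqrt m2 * Num.sqrt s.
have k0 : 0 < k by exact: mulr_gt0.
(* The overshoot error is a / k times the displayed quotient divided by [N], so this [N] makes it at
   most a / k. *)
have [N N0 hN] : exists2 N : nat, (0 < N)%N & forall a, ba = Some a ->
    5 * m4 / (m2 ^+ 2 * (a / k) ^+ 4) <= N%:R.
  case: ba {ba0} => [a|]; last by exists 1%N.
  exists (Num.truncn (5 * m4 / (m2 ^+ 2 * (a / k) ^+ 4))).+1 => // _ [<-].
  by rewrite ltW// truncnS_gt.
have Nn0 : 0 < N%:R :> R by rewrite ltr0n.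
exists N => //.
have [mY [Y0 _]] := BY.
pose nu_ k : probability R R :=
  gauss (Num.sqrt (grid s N n k.+1 - grid s N n k)).
have bP : forall m (B : nat -> set R), (forall k, measurable (B k)) ->
    P (\bigcap_(k in `I_m)
      [set w | B k (Y (grid s N n k.+1) w - Y (grid s N n k) w)]) =
    \big[*%E/1%E]_(k < m) nu_ k (B k).
  exact: brownian_boxP BY (grid0 s N n) (grid_incr s0 N0 n0).
have mS i : measurable_fun setT (Y (grid s N n i)) by exact: mY.
have S0 w : Y (grid s N n 0) w = 0 by rewrite grid0.
rewrite /confined (stays_blocks mS S0 bP (measurable_lowset ba))//; last first.
  exact: measurable_blockset.
have p10 : (0 <= P (stays (fun k => Y (grid s N n k)) (lowset ba) N.+1))%E.
  exact: measure_ge0.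
have h1 : (P (stays (fun k => Y (grid s N n k)) (lowset ba) N.+1) <=
    (scaled (C1 + C2) s ba)%:E)%E.
  case: ba ba0 hN {p10} => [a|] ba0 hN; last first.
    rewrite /scaled; apply: probability_le1; apply: (measurable_stays mS S0).
    exact: measurable_lowset.
  have a0 : 0 < a by exact: ba0.
  pose sg := Num.sqrt (s / N%:R).
  have sg0 : 0 < sg by rewrite sqrtr_gt0 divr_gt0.
  have sg2 : sg ^+ 2 = s / N%:R by rewrite sqr_sqrtr// divr_ge0// ltW.
  have nuE i : (i < N)%N -> nu_ i = gauss sg.
    by move=> iN; rewrite /nu_ grid_stepl.
  rewrite (walk_stays mS S0 bP (measurable_lowset (Some a)) nuE).
  have [I2 I4] := mom sg sg0.
  have Nk : N%:R * (m2 * sg ^+ 2) = k ^+ 2.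
    rewrite sg2 /k exprMn !sqr_sqrtr ?ltW//; field; exact: lt0r_neq0.
  have := @surv_halfline_upper R (gauss sg) _ _
    (fun f mf f0 => gauss_symmetric (lt0r_neq0 sg0) mf f0) I2 I4
    (lowset (Some a)) (measurable_lowset (Some a)) N k a erefl k0 a0 N0 Nk.
  move=> h.
  rewrite -[X in (X <= _)%E]fineK; last first.
    rewrite ge0_fin_numE ?surv_ge0//.
    exact: le_lt_trans (surv_le1 _ (measurable_lowset (Some a)) _ _) (ltry _).
  rewrite lee_fin; apply: le_trans h _.
  set dl := a / k.
  have dl0 : 0 < dl by exact: divr_gt0.
  apply: (@le_trans _ _ (9 * dl)).
    suff : N%:R * (5 * (m4 * sg ^+ 4) / (k ^+ 4 * dl ^+ 3)) <= dl by lra.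
    have -> : N%:R * (5 * (m4 * sg ^+ 4) / (k ^+ 4 * dl ^+ 3)) =
        5 * m4 / (m2 ^+ 2 * dl ^+ 4) / N%:R * dl.
      rewrite -[sg ^+ 4]/(sg ^+ (2 * 2)) -[k ^+ 4]/(k ^+ (2 * 2)) !exprM -Nk sg2.
      by field; rewrite !gt_eqF.
    rewrite ler_piMl ?(ltW dl0)// ler_pdivrMr// mul1r.
    exact: hN.
  rewrite /scaled /dl /k.
  have -> : 9 * (a / (Num.sqrt m2 * Num.sqrt s)) = C1 * (a / Num.sqrt s).
    by rewrite /C1; field; rewrite !gt_eqF.
  by rewrite ler_pM2r ?divr_gt0// lerDl ltW.
have h2 : (\big[*%E/1%E]_(l < n) gauss (Num.sqrt
    (grid s N n (N + l).+1 - grid s N n (N + l))) (blockset bb) <=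
    (scaled (C1 + C2) s bb ^+ n)%:E)%E.
  rewrite (eq_bigr (fun=> gauss (Num.sqrt (s / n%:R)) (blockset bb))); last first.
    by move=> l _; rewrite grid_stepr.
  have : (gauss (Num.sqrt (s / n%:R)) (blockset bb) <=
      (scaled (C1 + C2) s bb)%:E)%E.
    case: bb bb0 => [b|] bb0; last first.
      exact: (probability_le1 (gauss (Num.sqrt (s / n%:R))) measurableT).
    have b0 : 0 < b by exact: bb0.
    rewrite /= (le_trans (normal_small_ball _ _))//.
    - by rewrite sqrtr_gt0 divr_gt0// ltr0n.
    - by rewrite mulr_ge0// ltW.
    rewrite lee_fin sqrtrM ?ltW// sqrtrV ?ler0n//.
    have -> : 2 * (2 * b) / (Num.sqrt s / Num.sqrt n%:R) = C2 * (b / Num.sqrt s).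
      by rewrite /C2; field; rewrite !gt_eqF// sqrtr_gt0 ltr0n.
    by rewrite /scaled ltr_pM2r ?divr_gt0// ltrDr.
  have : (0 <= gauss (Num.sqrt (s / n%:R)) (blockset bb))%E by exact: measure_ge0.
  move: (gauss (Num.sqrt (s / n%:R)) (blockset bb)) => x x0 x1.
  elim: (n) => [|m ih]; first by rewrite big_ord0 expr0.
  rewrite big_ord_recr/= exprSr EFinM lee_pmul//.
  by apply: prode_ge0 => i _.
rewrite EFinM lee_pmul//.
by apply: prode_ge0 => i _; exact: measure_ge0.
Qed.
End brownian.

(** * Dyadic grids and the lower bound for confinement *)

Section dyadic.
Context (R : realType).

Lemma dyadic_approx (u e s : R) : 0 < u -> 0 < e -> 0 <= s -> s <= u ->
  exists m k, (k <= 2 ^ m)%N /\ `|s - k%:R * (u / (2 ^ m)%:R)| < e.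
Proof.
move=> u0 e0 s0 su.
pose m := (Num.truncn (u / e)).+1.
have ume : u < e * (2 ^ m)%:R.
  rewrite mulrC -ltr_pdivrMr//; apply: (lt_trans (truncnS_gt _)).
  by rewrite ltr_nat ltn_expl.
have m0 : 0 < (2 ^ m)%:R :> R by rewrite ltr0n expn_gt0.
pose h := u / (2 ^ m)%:R.
have h0 : 0 < h by exact: divr_gt0.
have he : h < e by rewrite /h ltr_pdivrMr.
exists m, (Num.truncn (s / h)).
have sh0 : 0 <= s / h by rewrite divr_ge0// ltW.
have /andP[k1 k2] := truncn_itv sh0.
rewrite -/h; split.
  rewrite -(ler_nat R); apply: (le_trans k1).
  rewrite ler_pdivrMr//; apply: (le_trans su).
  by rewrite /h mulrCA divff ?mulr1 ?gt_eqF.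
move: k1 k2; rewrite ler_pdivlMr// ltr_pdivrMr// -natr1 mulrDl mul1r => k1 k2.
by rewrite ger0_norm; lra.
Qed.

Lemma dyadic_dense (g : R -> R) (u al be : R) : 0 < u ->
  {within [set s : R | 0 <= s], continuous g} ->
  (forall m k, (k <= 2 ^ m)%N -> al <= g (k%:R * (u / (2 ^ m)%:R)) <= be) ->
  forall s, 0 <= s -> s <= u -> al <= g s <= be.
Proof.
move=> u0 /subspace_continuousP cg h s s0 su.
have gs := cg s s0.
have key (U : set R) : nbhs (g s) U -> exists2 y, U y & al <= y <= be.
  move=> /gs; rewrite /= -nbhs_ballE/= => -[e /= e0 eU].
  have [m [k [km sk]]] := dyadic_approx u0 e0 s0 su.
  exists (g (k%:R * (u / (2 ^ m)%:R))); last exact: h.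
  by apply: eU => //=; rewrite mulr_ge0// divr_ge0 ?ltW.
apply/andP; split; rewrite leNgt; apply/negP => gsb.
  have [y /= yl /andP[y1 _]] := key _ (lt_nbhsl gsb).
  by move: yl; rewrite ltNge y1.
have [y /= yl /andP[_ y1]] := key _ (lt_nbhsr gsb).
by move: yl; rewrite ltNge y1.
Qed.

Definition dyadic_stay d (T : measurableType d) (Y : R -> T -> R) (u : R)
    (I : set R) (m : nat) : set T :=
  stays (fun k => Y (k%:R * (u / (2 ^ m)%:R))) I (2 ^ m).+1.

Lemma measurable_dyadic_stay d (T : measurableType d) (Y : R -> T -> R) u I m :
  (forall s, measurable_fun setT (Y s)) -> measurable I ->
  measurable (dyadic_stay Y u I m).
Proof.
move=> mY mI; apply: bigcap_measurableType => k _.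
by rewrite -[X in measurable X]setTI; exact: mY.
Qed.

(** The horizon is 2 r^2 rather than r^2 because confinement on [0, u] gives an exit time at least
    u, while a strict inequality is wanted at r^2. *)
Lemma brownian_stay_ge : exists c K : R, 0 < c /\ 0 < K /\
  forall d (T : measurableType d) (P : probability T R) (Y : R -> T -> R),
  brownian_motion P Y -> forall r a : R, 0 < r -> 0 < a -> a <= r ->
  ((c * (a / r))%:E <=
   P (\bigcap_m dyadic_stay Y (2 * r ^+ 2) `[(- a)%R, (K * r)%R] m))%E.
Proof.
have [m2 [m4 [m20 [m40 mom]]]] := gauss_moments R.
(* The length k of [surv_strip_lower] satisfies k^2 = m2 (2 r^2), so k = [q] r, and the upper level
   2 [q] r is 2k. The factor [c1] shrinks a to meet its condition a' <= k / 2. *)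
pose q := Num.sqrt (2 * m2).
have q0 : 0 < q by rewrite sqrtr_gt0 mulr_gt0.
have q2 : q ^+ 2 = 2 * m2 by rewrite sqr_sqrtr// mulr_ge0// ltW.
pose c1 := Num.min 1 (q / 2).
have c10 : 0 < c1 by rewrite lt_min ltr01 divr_gt0.
have c11 : c1 <= 1 by rewrite ge_min lexx.
have c1q : c1 <= q / 2 by rewrite ge_min lexx orbT.
exists (3 / 32 * (c1 / q)), (2 * q); split; first by rewrite mulr_gt0// divr_gt0.
split; first by rewrite mulr_gt0.
move=> d T P Y BY r a r0 a0 ar.
have [mY [Y0 _]] := BY.
pose a' := c1 * a.
have a'0 : 0 < a' by exact: mulr_gt0.
have a'a : a' <= a by rewrite /a' ler_piMl// ltW.
pose u := 2 * r ^+ 2.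
have r20 : 0 < r ^+ 2 by exact: exprn_gt0.
have u0 : 0 < u by rewrite mulr_gt0.
pose I := `[(- a')%R, (2 * q * r)%R]%classic.
have mI : measurable I by exact: measurable_itv.
pose k := q * r.
have k0 : 0 < k by exact: mulr_gt0.
pose F m := dyadic_stay Y u I m.
have mF m : measurable (F m) by exact: measurable_dyadic_stay.
have mbF : measurable (\bigcap_m F m) by exact: bigcap_measurableType.
have lb m : ((3 / 32 * (a' / k) - m4 / (8 * m2 ^+ 2) / (2 ^ m)%:R)%:E <= P (F m))%E.
  pose N := (2 ^ m)%N.
  have N0 : 0 < N%:R :> R by rewrite ltr0n expn_gt0.
  pose t (i : nat) : R := i%:R * (u / N%:R).
  have h0 : 0 < u / N%:R by exact: divr_gt0.
  have t0 : t 0%N = 0 by rewrite /t mul0r.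
  have tD i : t i.+1 - t i = u / N%:R.
    by rewrite /t -natr1 mulrDl mul1r addrC addKr.
  have tS i : t i < t i.+1 by rewrite -subr_gt0 tD.
  pose sg := Num.sqrt (u / N%:R).
  have sg0 : 0 < sg by rewrite sqrtr_gt0.
  have sg2 : sg ^+ 2 = u / N%:R by rewrite sqr_sqrtr// ltW.
  pose nu_ i : probability R R := gauss (Num.sqrt (t i.+1 - t i)).
  have nuE i : (i < N)%N -> nu_ i = gauss sg by move=> _; rewrite /nu_ tD.
  have bP : forall n (B : nat -> set R), (forall i, measurable (B i)) ->
      P (\bigcap_(i in `I_n) [set w | B i (Y (t i.+1) w - Y (t i) w)]) =
      \big[*%E/1%E]_(i < n) nu_ i (B i).
    exact: brownian_boxP BY t0 tS.
  have mS i : measurable_fun setT (Y (t i)) by exact: mY.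
  have S0 w : Y (t 0%N) w = 0 by rewrite t0.
  have -> : P (F m) = surv (gauss sg) I N 0 := walk_stays mS S0 bP mI nuE.
  have [I2 I4] := mom sg sg0.
  have Nk : N%:R * (m2 * sg ^+ 2) = k ^+ 2.
    by rewrite sg2 /k exprMn q2 /u; field; rewrite gt_eqF.
  have ak : a' <= k / 2.
    rewrite /a' /k mulrAC; apply: ler_pM => //; exact: ltW.
  have kab : 2 * k <= a' + 2 * q * r by rewrite /k mulrA lerDr ltW.
  have := @surv_strip_lower R (gauss sg) _ _
    (fun f mf f0 => gauss_symmetric (lt0r_neq0 sg0) mf f0) I2 I4 I mI N k a'
    (2 * q * r) erefl k0 a'0 ak kab Nk.
  move=> h.
  rewrite -[X in (_ <= X)%E]fineK; last first.
    rewrite ge0_fin_numE ?surv_ge0//.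
    exact: le_lt_trans (surv_le1 _ mI _ _) (ltry _).
  rewrite lee_fin; apply: le_trans h.
  rewrite lerD2l lerN2.
  have -> : N%:R * (m4 * sg ^+ 4 / (8 * k ^+ 4)) = m4 / (8 * m2 ^+ 2) / N%:R.
    rewrite -[sg ^+ 4]/(sg ^+ (2 * 2)) -[k ^+ 4]/(k ^+ (2 * 2)) !exprM -Nk sg2.
    by field; rewrite !gt_eqF.
  by [].
have nF : nonincreasing_seq F.
  apply/nonincreasing_seqP => m; apply/subsetPset => w Fw i /= iN.
  have i2 : (2 * i < (2 ^ m.+1).+1)%N by rewrite ltnS expnS leq_pmul2l.
  have := Fw (2 * i)%N i2; rewrite /=.
  rewrite (_ : (2 * i)%:R * (u / (2 ^ m.+1)%:R) = i%:R * (u / (2 ^ m)%:R))//.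
  by rewrite expnS !natrM; field; rewrite pnatr_eq0 expn_eq0.
have F0oo : (P (F 0%N) < +oo)%E.
  exact: le_lt_trans (probability_le1 P (mF 0%N)) (ltry _).
(* The events decrease as the grids refine, so the intersection has the limiting probability; the
   overshoot error, of order 1 / 2^m, disappears. *)
have cF := nonincreasing_cvg_mu F0oo mF mbF nF.
have sub : \bigcap_m F m `<=`
    \bigcap_m dyadic_stay Y u `[(- a)%R, (2 * q * r)%R] m.
  move=> w Fw m _ i /= iN; have := Fw m Logic.I i iN; rewrite /= /I/= in_itv/= => /andP[h1 h2].
  by rewrite in_itv/= h2 andbT (le_trans _ h1)// lerN2.
apply: (@le_trans _ _ (P (\bigcap_m F m))); last first.
  apply: le_measure; rewrite ?inE//.
  apply: bigcap_measurableType => m _; exact: measurable_dyadic_stay.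
have -> : 3 / 32 * (c1 / q) * (a / r) = 3 / 32 * (a' / k).
  by rewrite /a' /k; field; rewrite !gt_eqF.
set e0 := m4 / _ in lb.
apply/lee_addgt0Pr => e e_gt0; rewrite -leeBlDr// -EFinB.
apply: (cvge_ge _ cF).
exists (Num.truncn (e0 / e)) => // m /= em; apply: le_trans (lb m).
rewrite lee_fin lerD2l lerN2.
have m0 : 0 < (2 ^ m)%:R :> R by rewrite ltr0n expn_gt0.
rewrite ler_pdivrMr// mulrC -ler_pdivrMr//; apply: (le_trans (ltW (truncnS_gt _))).
by rewrite ler_nat (leq_trans _ (ltn_expl m (ltnSn 1))).
Qed.
End dyadic.

(** * The event that the exit time exceeds t *)

Section exit_event.
Context (R : realType) (d : measure_display) (T : measurableType d).
Variables (Y : R -> T -> R) (a b : T -> R).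

Lemma exit_time_gt t w : (t%:E < exit_time Y a b w)%E ->
  forall s, 0 <= s -> s <= t -> - a w < Y s w < b w.
Proof.
move=> tw s s0 st; apply: contrapT => nY.
move: tw; rewrite ltNge => /negP; apply.
by apply: (@le_trans _ _ s%:E); [apply: ereal_inf_lbound; exists s|rewrite lee_fin].
Qed.

Lemma exit_time_ge u w : (forall s, 0 <= s -> s <= u -> - a w < Y s w < b w) ->
  (u%:E <= exit_time Y a b w)%E.
Proof.
move=> h; apply: le_ereal_inf_tmp => _ [s [s0 sY] <-].
by rewrite lee_fin leNgt; apply/negP => su; apply: sY; apply: h => //; exact: ltW.
Qed.

Lemma exit_time_gt_slack t w : (t%:E < exit_time Y a b w)%E ->
  exists n : nat, ((t + n.+1%:R^-1)%:E < exit_time Y a b w)%E.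
Proof.
case: (exit_time Y a b w) => [e| |]//; last by exists 0%N; rewrite ltry.
rewrite lte_fin => te; exists (Num.truncn (e - t)^-1).
rewrite lte_fin -ltrBrDl invf_plt ?posrE ?subr_gt0//.
by rewrite truncnS_gt.
Qed.

Hypothesis cY : forall w, {within [set s : R | 0 <= s], continuous (fun s => Y s w)}.
Hypothesis mY : forall s, measurable_fun setT (Y s).
Hypothesis ma : measurable_fun setT a.
Hypothesis mb : measurable_fun setT b.

Let slack (t : R) (n m l k : nat) : set T :=
  [set w | - a w + m.+1%:R^-1 <= Y (k%:R * ((t + n.+1%:R^-1) / (2 ^ l)%:R)) w
    /\ Y (k%:R * ((t + n.+1%:R^-1) / (2 ^ l)%:R)) w <= b w - m.+1%:R^-1].

(** An exit time beyond t exceeds some t + 1 / (n + 1). On that compact time interval the extreme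
    values of the path turn strict confinement into confinement with a margin 1 / (m + 1), a closed
    condition that can be tested at dyadic times. *)
Lemma measurable_exit_gt (t : R) : 0 <= t ->
  measurable [set w | (t%:E < exit_time Y a b w)%E].
Proof.
move=> t0.
rewrite (_ : [set w | _] = \bigcup_n \bigcup_m \bigcap_l
    \bigcap_(k in [set k | (k <= 2 ^ l)%N]) slack t n m l k).
  apply: bigcup_measurable => n _; apply: bigcup_measurable => m _.
  apply: bigcap_measurableType => l _; apply: bigcap_measurableType => k _.
  apply: measurableI; rewrite -[X in measurable X]setTI.
    by apply: measurable_fun_le => //; apply: measurable_funD => //; exact: measurableT_comp.
  by apply: measurable_fun_le => //; exact: measurable_funB.
apply/seteqP; split=> w /=.
  move=> /exit_time_gt_slack[n nw]; exists n => //.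
  set u := t + n.+1%:R^-1 in nw *.
  have u0 : 0 < u by rewrite ltr_wpDl// invr_gt0.
  have hw := exit_time_gt nw.
  have cw : {within `[0, u], continuous (fun s => Y s w)}.
    apply: (@continuous_subspaceW _ _ _ [set s : R | 0 <= s]); last exact: cY.
    by move=> s /=; rewrite in_itv/= => /andP[].
  have [c1 c1u c1h] := EVT_min (ltW u0) cw.
  have [c2 c2u c2h] := EVT_max (ltW u0) cw.
  move: c1u c2u; rewrite !in_itv/= => /andP[c10 c1u] /andP[c20 c2u].
  have /andP[h1 _] := hw c1 c10 c1u; have /andP[_ h2] := hw c2 c20 c2u.
  pose e : R := Num.min (Y c1 w + a w) (b w - Y c2 w).
  have e0 : 0 < e by rewrite lt_min subr_gt0 h2 andbT; lra.
  exists (Num.truncn e^-1) => // l _ k /= kl.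
  have me : (Num.truncn e^-1).+1%:R^-1 < e.
    by rewrite invf_plt ?posrE// truncnS_gt.
  have su : k%:R * (u / (2 ^ l)%:R) \in `[0, u].
    have l0 : 0 < (2 ^ l)%:R :> R by rewrite ltr0n expn_gt0.
    rewrite in_itv/=; apply/andP; split.
      by rewrite mulr_ge0// divr_ge0 ?ltW.
    by rewrite mulrCA ler_piMr ?(ltW u0)// ler_pdivrMr// mul1r ler_nat.
  have := c1h _ su; have := c2h _ su.
  have : e <= Y c1 w + a w by rewrite ge_min lexx.
  have : e <= b w - Y c2 w by rewrite ge_min lexx orbT.
  move=> e1 e2 y1 y2; rewrite /slack/= -/u.
  by move: (_.+1%:R^-1) (Y _ w) me y1 y2 => v z me y1 y2; split; lra.
move=> [n _ [m _ h]]; set u := t + n.+1%:R^-1 in h.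
have n0 : 0 < n.+1%:R^-1 :> R by rewrite invr_gt0.
have m0 : 0 < m.+1%:R^-1 :> R by rewrite invr_gt0.
have u0 : 0 < u by rewrite ltr_wpDl.
apply: (@lt_le_trans _ _ u%:E); first by rewrite lte_fin ltrDl.
apply: exit_time_ge => s s0 su.
have /andP[h1 h2] : - a w + m.+1%:R^-1 <= Y s w <= b w - m.+1%:R^-1.
  apply: (dyadic_dense u0 (@cY w) _ s0 su) => l k kl.
  by have [? ?] := h l Logic.I k kl; apply/andP.
by move: (_^-1) m0 h1 h2 => v m0 h1 h2; apply/andP; split; lra.
Qed.

Lemma dyadic_stay_exit (u t x y : R) w : 0 < u -> t < u ->
  (\bigcap_m dyadic_stay Y u `[(- x)%R, y] m) w -> x < a w -> y < b w ->
  (t%:E < exit_time Y a b w)%E.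
Proof.
move=> u0 tu h xa yb; apply: (@lt_le_trans _ _ u%:E); first by rewrite lte_fin.
apply: exit_time_ge => s s0 su.
have /andP[h1 h2] : - x <= Y s w <= y.
  apply: (dyadic_dense u0 (@cY w) _ s0 su) => m k km.
  by have := h m Logic.I k; rewrite /= in_itv/= ltnS; exact.
by apply/andP; split; lra.
Qed.
End exit_event.

Section cover.
Context (R : realType) (d : measure_display) (T : measurableType d).

Lemma confined_cover (Y : R -> T -> R) (s : R) (N n : nat) (ba bb : option R)
    (x y : R) w : 0 < s -> (0 < N)%N -> (0 < n)%N ->
  (forall u, 0 <= u -> u <= 2 * s -> - x < Y u w < y) ->
  (forall c, ba = Some c -> x <= c) -> (forall c, bb = Some c -> x + y <= 2 * c) ->
  confined Y s N n ba bb w.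
Proof.
move=> s0 N0 n0 h hx hy.
have hg k : (k <= N + n)%N -> - x < Y (grid s N n k) w < y.
  by move=> kN; apply: h; [exact: grid_ge0|exact: grid_le].
split=> [k /= kN|l /= ln].
  have /andP[h1 _] : - x < Y (grid s N n k) w < y.
    by apply: hg; rewrite (leq_trans _ (leq_addr _ _)).
  rewrite /lowset; case: ba hx => [c|]//= /(_ c erefl) xc.
  by rewrite in_itv/= andbT; lra.
have lN1 : ((N + l).+1 <= N + n)%N by rewrite -addnS leq_add2l.
have /andP[h1 h2] := hg _ lN1; have /andP[h3 h4] := hg _ (ltnW lN1).
rewrite /blockset; case: bb hy => [c|]//= /(_ c erefl) xc.
by rewrite in_itv/=; apply/andP; split; lra.
Qed.
End cover.

(** * Path events in the sigma-algebra of the process *)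

Section proc_events.
Context (R : realType) (d : measure_display) (T : measurableType d).
Variable Y : R -> T -> R.

Let G := \bigcup_(s in [set s : R | 0 <= s]) preimage_set_system setT (Y s) measurable.

Let mGY s : 0 <= s -> measurable_fun setT (Y s : g_sigma_algebraType G -> R).
Proof.
move=> s0 _ B mB; apply: sub_sigma_algebra; exists s => //.
by exists B.
Qed.

Lemma sigma_proc_dyadic_stay u I : 0 <= u -> measurable I ->
  sigma_proc Y (\bigcap_m dyadic_stay Y u I m).
Proof.
move=> u0 mI; apply: (@bigcapT_measurable _ (g_sigma_algebraType G)) => m.
apply: (@bigcap_measurableType _ (g_sigma_algebraType G)) => k _.
rewrite -[X in measurable X]setTI; apply: mGY => //.
by rewrite mulr_ge0// divr_ge0.
Qed.

Lemma sigma_proc_confined s N n ba bb : 0 < s -> (0 < N)%N -> (0 < n)%N ->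
  sigma_proc Y (confined Y s N n ba bb).
Proof.
move=> s0 N0 n0.
have mYg k : measurable_fun setT (Y (grid s N n k) : g_sigma_algebraType G -> R).
  by apply: mGY; exact: grid_ge0.
apply: (@measurableI _ (g_sigma_algebraType G)).
  apply: (@bigcap_measurableType _ (g_sigma_algebraType G)) => k _.
  by rewrite -[X in measurable X]setTI; apply: mYg => //; exact: measurable_lowset.
apply: (@bigcap_measurableType _ (g_sigma_algebraType G)) => l _.
rewrite -[X in measurable X]setTI.
by apply: (measurable_funB (mYg _) (mYg _)) => //; exact: measurable_blockset.
Qed.

Lemma sigma_proc_confinedN s N n ba bb : 0 < s -> (0 < N)%N -> (0 < n)%N ->
  sigma_proc Y (confined (fun s w => - Y s w) s N n ba bb).
Proof.
move=> s0 N0 n0.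
have mYg k : measurable_fun setT
    ((fun w => - Y (grid s N n k) w) : g_sigma_algebraType G -> R).
  by apply: measurableT_comp => //; apply: mGY; exact: grid_ge0.
apply: (@measurableI _ (g_sigma_algebraType G)).
  apply: (@bigcap_measurableType _ (g_sigma_algebraType G)) => k _.
  by rewrite -[X in measurable X]setTI; apply: mYg => //; exact: measurable_lowset.
apply: (@bigcap_measurableType _ (g_sigma_algebraType G)) => l _.
rewrite -[X in measurable X]setTI.
by apply: (measurable_funB (mYg _) (mYg _)) => //; exact: measurable_blockset.
Qed.

Lemma measurable_sigma_proc A : (forall s, measurable_fun setT (Y s)) ->
  sigma_proc Y A -> measurable A.
Proof.
move=> mY; apply: smallest_sub; first exact: sigma_algebra_measurable.
by move=> _ [s _ [B mB <-]]; exact: mY.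
Qed.

Lemma sigma_rv_preimage (X : T -> R) B : measurable B -> sigma_rv X (X @^-1` B).
Proof. by move=> mB; apply: sub_sigma_algebra; exists B => //; rewrite setTI. Qed.
End proc_events.

(** * Dyadic decomposition of the endpoints *)

Section tails.
Context (R : realType).

Lemma density_interval_bounds d (T : measurableType d) (P : probability T R)
    (X : T -> R) (f : R -> R) (x y lo hi : R) :
  has_density P X f -> x <= y -> 0 <= lo ->
  (forall z, x < z -> z <= y -> lo <= f z <= hi) ->
  ((lo * (y - x))%:E <= P (X @^-1` `]x, y]) <= (hi * (y - x))%:E)%E.
Proof.
move=> [_ [mf [f0 ->//]]] xy lo0 h.
have itvE (c : R) : (\int[lebesgue_measure]_(z in `]x, y]) c%:E = (c * (y - x))%:E)%E.
  rewrite integral_cst//= lebesgue_measure_itv/= lte_fin.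
  have [xy'|yx] := ltP x y; first by rewrite -EFinD -EFinM.
  have -> : y = x by apply/eqP; rewrite eq_le yx.
  by rewrite subrr mulr0 mule0.
have mfE : measurable_fun `]x, y] (EFin \o f).
  by apply/measurable_EFinP; exact: measurable_funTS.
rewrite -!itvE; apply/andP; split; apply: ge0_le_integral => //.
- by move=> z /=; rewrite in_itv/= => /andP[z1 z2]; rewrite lee_fin; case/andP: (h z z1 z2).
- by move=> z _; rewrite lee_fin.
- by move=> z /=; rewrite in_itv/= => /andP[z1 z2]; rewrite lee_fin; case/andP: (h z z1 z2).
Qed.

Lemma powR_double (p A : R) i : 0 < A ->
  (2 ^+ i * A) `^ (- p) = A `^ (- p) * (2 `^ (- p)) ^+ i.
Proof.
move=> A0; rewrite powRM ?exprn_ge0 ?ltW// mulrC; congr (_ * _).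
elim: i => [|i ih]; first by rewrite !expr0 powR1.
by rewrite !exprS powRM ?exprn_ge0// ih.
Qed.

(** Beyond [A] the density is within a factor 2 of its asymptotic form. The constants come from [f]
    alone and therefore serve both endpoints. *)
Lemma pareto_tails (f : R -> R) (C p : R) : 0 < C -> 0 < p ->
  f t / (C * t `^ (- (p + 1))) @[t --> +oo] --> (1 : R) ->
  exists A c D : R, [/\ 0 < A, 0 < c, 0 < D &
  forall d (T : measurableType d) (P : probability T R) (X : T -> R),
  has_density P X f -> forall i : nat,
  ((c * (2 `^ (- p)) ^+ i)%:E <=
     P (X @^-1` `](2 ^+ i * A)%R, (2 ^+ i.+1 * A)%R]))%E /\
  (P (X @^-1` `](2 ^+ i * A)%R, +oo[) <= (D * (2 `^ (- p)) ^+ i)%:E)%E].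
Proof.
move=> C0 p0 fC.
have [A A0 hA] : exists2 A, 0 < A & forall t, A <= t ->
    C / 2 * t `^ (- (p + 1)) <= f t <= 2 * C * t `^ (- (p + 1)).
  have n1 : \forall t \near +oo, 2^-1 < f t / (C * t `^ (- (p + 1))).
    by apply: (cvgr_gt 1 fC); lra.
  have n2 : \forall t \near +oo, f t / (C * t `^ (- (p + 1))) < 2.
    by apply: (cvgr_lt 1 fC); lra.
  have [B [Br hB]] : \forall t \near +oo,
      2^-1 < f t / (C * t `^ (- (p + 1))) /\ f t / (C * t `^ (- (p + 1))) < 2.
    by near=> t; split; near: t.
  exists (Num.max 1 (B + 1)); first by rewrite lt_max ltr01.
  move=> t; rewrite ge_max => /andP[t1 tB].
  have t0 : 0 < t by lra.
  have p1 : 0 < C * t `^ (- (p + 1)) by rewrite mulr_gt0// powR_gt0.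
  have [|] := hB t; first by lra.
  rewrite ltr_pdivlMr// ltr_pdivrMr// => h1 h2.
  by apply/andP; split; lra.
pose th : R := 2 `^ (- p).
have th0 : 0 < th by rewrite powR_gt0.
have th1 : th < 1.
  rewrite /th /powR pnatr_eq0/= expR_lt1 mulNr oppr_lt0 mulr_gt0// ln_gt0//; lra.
have Ap : 0 < A `^ (- p) by exact: powR_gt0.
pose D0 := 2 * C * A `^ (- p).
(* A shell (x, 2x] has length x, and the power is smallest at 2x and largest at x; the tail constant
   sums the shells as a geometric series of ratio [th]. *)
exists A, (C / 2 * 2 `^ (- (p + 1)) * A `^ (- p)), (D0 / (1 - th)).
have D00 : 0 < D0 by rewrite mulr_gt0// mulr_gt0.
split=> //.
- by rewrite mulr_gt0// mulr_gt0 ?powR_gt0// divr_gt0.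
- by rewrite divr_gt0// subr_gt0.
move=> d T P X Xf i.
have [mX _] := Xf.
have bd (j : nat) :
    ((C / 2 * 2 `^ (- (p + 1)) * A `^ (- p) * th ^+ j)%:E <=
     P (X @^-1` `](2 ^+ j * A)%R, (2 ^+ j.+1 * A)%R]) <=
     (D0 * th ^+ j)%:E)%E.
  set x := 2 ^+ j * A.
  have j1 : 1 <= 2 ^+ j :> R by rewrite exprn_ege1//; lra.
  have x0 : 0 < x by rewrite mulr_gt0// exprn_gt0.
  have Ax : A <= x by rewrite /x ler_peMl// ltW.
  have -> : 2 ^+ j.+1 * A = 2 * x by rewrite exprS mulrA.
  have xx : x <= 2 * x by lra.
  have px : x * x `^ (- (p + 1)) = A `^ (- p) * th ^+ j.
    rewrite -powR_double// -/x -{1}(powRr1 (ltW x0)) -powRD; last first.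
      by apply/implyP => _; rewrite gt_eqF.
    by congr (_ `^ _); ring.
  have mono z w : 0 < z -> z <= w -> w `^ (- (p + 1)) <= z `^ (- (p + 1)).
    move=> z0 zw; rewrite !powRN lef_pV2 ?posrE ?powR_gt0//; last first.
      exact: lt_le_trans zw.
    by apply: ge0_ler_powR => //; rewrite ?nnegrE; lra.
  have := density_interval_bounds (lo := C / 2 * (2 * x) `^ (- (p + 1)))
    (hi := 2 * C * x `^ (- (p + 1))) Xf xx.
  move=> /(_ _ _)/andP[||].
  - by rewrite mulr_ge0 ?powR_ge0// divr_ge0// ltW.
  - move=> z xz zx; have /andP[h1 h2] := hA z (le_trans Ax (ltW xz)).
    have z0 : 0 < z by exact: lt_trans xz.
    apply/andP; split.
      by apply: le_trans h1; rewrite ler_pM2l ?divr_gt0//; exact: mono.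
    by apply: (le_trans h2); rewrite ler_pM2l ?mulr_gt0//; apply: mono => //; exact: ltW.
  rewrite (_ : 2 * x - x = x); last by ring.
  move=> h1 h2; apply/andP; split.
    rewrite (le_trans _ h1)// lee_fin -mulrA -px.
    rewrite (@powRM _ 2 x _ (ler0n _ 2) (ltW x0)).
    by rewrite le_eqVlt; apply/orP; left; apply/eqP; ring.
  rewrite (le_trans h2)// lee_fin.
  have -> : D0 * th ^+ j = 2 * C * (A `^ (- p) * th ^+ j) by rewrite /D0; ring.
  rewrite -px.
  by rewrite le_eqVlt; apply/orP; left; apply/eqP; ring.
split; first by case/andP: (bd i).
pose F k := X @^-1` `](2 ^+ k * A)%R, +oo[.
have mF k : measurable (F k).
  by rewrite -[X in measurable X]setTI; exact: mX.
have mB k : measurable (X @^-1` `](2 ^+ k * A)%R, (2 ^+ k.+1 * A)%R]).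
  by rewrite -[X in measurable X]setTI; exact: mX.
(* [n] shells and a remainder, which tends to 0 because the sets [F] decrease to the empty set. *)
have tail k n : (P (F k) <= (D0 * (th ^+ k * ((1 - th ^+ n) / (1 - th))))%:E + P (F (k + n)%N))%E.
  elim: n k => [|n ih] k.
    by rewrite expr0 subrr mul0r !mulr0 add0e addn0.
  have -> : F k = X @^-1` `](2 ^+ k * A)%R, (2 ^+ k.+1 * A)%R] `|` F k.+1.
    have xx : 2 ^+ k * A <= 2 ^+ k.+1 * A.
      rewrite exprS -mulrA ler_peMl//; last by lra.
      by rewrite mulr_ge0 ?exprn_ge0// ltW.
    apply/seteqP; split=> w /=; rewrite /F/= !in_itv/= !andbT.
      by move=> kw; case: (lerP (X w) (2 ^+ k.+1 * A)) => h; [left; rewrite kw|right].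
    by move=> [/andP[]//|]; exact: le_lt_trans.
  apply: (le_trans (measureU2 _ (mB k) (mF k.+1))).
  have /andP[_ h1] := bd k.
  apply: (le_trans (leeD h1 (ih k.+1))).
  rewrite addSnnS addeA -EFinD leeD2r// lee_fin.
  rewrite le_eqVlt; apply/orP; left; apply/eqP.
  by rewrite !exprS; field; rewrite subr_eq0 gt_eqF.
have cF : (P \o F @ \oo --> P (\bigcap_n F n)).
  apply: nonincreasing_cvg_mu => //.
  - exact: le_lt_trans (probability_le1 P (mF 0%N)) (ltry _).
  - exact: bigcap_measurableType.
  - apply/nonincreasing_seqP => n; apply/subsetPset => w /=.
    rewrite /F/= !in_itv/= !andbT; apply: le_lt_trans.
    rewrite exprS -mulrA ler_peMl//; last by lra.
    by rewrite mulr_ge0 ?exprn_ge0// ltW.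
have F0 : \bigcap_n F n = set0.
  apply/seteqP; split=> // w Fw.
  pose n := Num.truncn (`|X w| / A).
  have := Fw n.+1 Logic.I; rewrite /F/= in_itv/= andbT ltNge => /negP; apply.
  apply: (le_trans (ler_norm _)); rewrite -ler_pdivrMr//.
  apply: (le_trans (ltW (truncnS_gt _))).
  by rewrite -natrX ler_nat ltnW// ltn_expl.
rewrite F0 measure0 in cF.
have cFi : P (F (i + n)%N) @[n --> \oo] --> 0%E.
  have := cF; rewrite -(cvg_shiftn i); apply: cvg_trans; apply: near_eq_cvg.
  by near=> n; rewrite /= addnC.
rewrite -sube_le0; apply: (cvge_ge _ cFi); near=> n.
rewrite leeBlDr// addeC; apply: (le_trans (tail i n)); rewrite leeD2r// lee_fin.
have -> : D0 / (1 - th) * 2 `^ (- p) ^+ i = D0 * (th ^+ i * (1 / (1 - th))).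
  by rewrite -/th; field; rewrite subr_eq0 gt_eqF.
rewrite ler_pM2l// ler_pM2l ?exprn_gt0// ler_pM2r ?invr_gt0 ?subr_gt0//.
by rewrite gerBl exprn_ge0// ltW.
Unshelve. all: by end_near. Qed.
End tails.

(** * Geometric sums and finite unions *)

Section finite_geometric.
Context (R : realType).

Lemma geom_sum_le (q : R) n : 2 <= q -> \sum_(i < n) q ^+ i <= q ^+ n.
Proof.
move=> q2; elim: n => [|n ih]; first by rewrite big_ord0 expr0.
rewrite big_ord_recr/= exprS.
have qn : 0 <= q ^+ n by rewrite exprn_ge0//; lra.
have : 2 * q ^+ n <= q * q ^+ n by rewrite ler_wpM2r.
lra.
Qed.

Lemma geom_sum_ge1 (q : R) n : 0 <= q -> 1 <= \sum_(i < n.+1) q ^+ i.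
Proof.
move=> q0; rewrite big_ord_recl/= expr0 lerDl sumr_ge0// => i _.
exact: exprn_ge0.
Qed.

Lemma geom_sumS_le (q : R) n : 0 <= q ->
  \sum_(i < n.+2) q ^+ i <= (1 + q) * \sum_(i < n.+1) q ^+ i.
Proof.
move=> q0; rewrite big_ord_recl/= expr0.
rewrite (_ : \sum_(i < n.+1) q ^+ bump 0 i = q * \sum_(i < n.+1) q ^+ i).
  by rewrite mulrDl mul1r lerD2r geom_sum_ge1.
by rewrite mulr_sumr; apply: eq_bigr => i _; rewrite /bump leq0n add1n exprS.
Qed.
End finite_geometric.

Section subadditivity.
Context (R : realType) (d : measure_display) (T : measurableType d)
  (P : probability T R).

Lemma probability_cover2 n (E : set T) (W : nat * nat -> set T) (w : nat * nat -> R) :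
  measurable E -> (forall ij, measurable (W ij)) ->
  (forall ij, (P (W ij) <= (w ij)%:E)%E) ->
  (forall x, E x -> exists i j, [/\ (i < n)%N, (j < n)%N & W (i, j) x]) ->
  (P E <= (\sum_(i < n) \sum_(j < n) w (i : nat, j : nat))%:E)%E.
Proof.
move=> mE mW Pw EW.
pose A i := \big[setU/set0]_(j < n) W (i, j : nat).
have mA i : measurable (A i) by apply: bigsetU_measurable => j _.
have PA i : (P (A i) <= (\sum_(j < n) w (i, j : nat))%:E)%E.
  rewrite -sumEFin; apply: (@le_trans _ _ (\sum_(j < n) P (W (i, j : nat)))%E).
    by apply: (@content_subadditive _ _ _ P _ (fun j => W (i, j))).
  by apply: lee_sum => j _; exact: Pw.
rewrite -sumEFin; apply: (@le_trans _ _ (\sum_(i < n) P (A i))%E); last first.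
  by apply: lee_sum => i _; exact: PA.
apply: (@content_subadditive _ _ _ P _ A) => // x /EW[i [j [ni nj Wx]]].
rewrite -bigcup_mkord; exists i => //.
by rewrite /A -(bigcup_mkord n (fun j => W (i, j))); exists j.
Qed.

Lemma probability_disjoint_sum n (E : set T) (V : nat -> set T) (v : nat -> R) :
  measurable E -> (forall i, measurable (V i)) -> trivIset setT V ->
  (forall i, (i < n)%N -> ((v i)%:E <= P (V i))%E) ->
  (forall i, (i < n)%N -> V i `<=` E) ->
  ((\sum_(i < n) v i)%:E <= P E)%E.
Proof.
move=> mE mV tV vV VE.
rewrite -sumEFin; apply: (@le_trans _ _ (\sum_(i < n) P (V i))%E).
  by apply: lee_sum => i _; exact: vV.
have mU : measurable (\big[setU/set0]_(i < n) V i) by apply: bigsetU_measurable.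
rewrite -(@measure_semi_additive_ord_I _ _ _ P V)//; last exact: sub_trivIset tV.
apply: le_measure; rewrite ?inE// -bigcup_mkord => x [i /= ni Vx].
exact: VE Vx.
Qed.
End subadditivity.

(** * Exit probabilities at dyadic times *)

Section dyadic_times.
Context (R : realType) (d : measure_display) (T : measurableType d).
Variables (P : probability T R) (f : R -> R) (p : R) (xi1 xi2 : T -> R)
  (Y : R -> T -> R).
Hypotheses (Xf1 : has_density P xi1 f) (Xf2 : has_density P xi2 f).
Hypothesis BY : brownian_motion P Y.
Hypothesis ind : indep3 P (sigma_rv xi1) (sigma_rv xi2) (sigma_proc Y).

Local Notation th := (2 `^ (- p) : R).
Local Notation E t := [set w | (t%:E < exit_time Y xi1 xi2 w)%E].
Local Notation Q M := (\sum_(i < M.+1) (2 * th) ^+ i).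

Let mY : forall s, measurable_fun setT (Y s). Proof. by case: BY. Qed.
Let cY : forall w, {within [set s : R | 0 <= s], continuous (fun s => Y s w)}.
Proof. by case: BY => [_ [_ []]]. Qed.
Let mx1 : measurable_fun setT xi1. Proof. by case: Xf1. Qed.
Let mx2 : measurable_fun setT xi2. Proof. by case: Xf2. Qed.

Let mE t : 0 <= t -> measurable (E t).
Proof. exact: measurable_exit_gt. Qed.

(** With r = 2^M A, the event contains disjoint pieces indexed by the shell i <= [M] of [xi1]. In
    each, [xi2] exceeds the level [K] r of [brownian_stay_ge], so the piece has probability at least
    a constant times th^i th^M 2^i / 2^M. *)
Lemma exit_dyadic_lower (A c D : R) : 0 < A -> 0 < c ->
  (forall X, has_density P X f -> forall i : nat,
    ((c * th ^+ i)%:E <=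
     P (X @^-1` `](2 ^+ i * A)%R, (2 ^+ i.+1 * A)%R]))%E /\
    (P (X @^-1` `](2 ^+ i * A)%R, +oo[) <= (D * th ^+ i)%:E)%E) ->
  exists2 L : R, 0 < L & forall M : nat,
    ((L * (Q M * (th / 2) ^+ M))%:E <= P (E ((2 ^+ M * A) ^+ 2)))%E.
Proof.
move=> A0 c0 tails.
have [b [K [b0 [K0 stay]]]] := brownian_stay_ge R.
have th0 : 0 < th by exact: powR_gt0.
(* [kp] extra doublings put [xi2] above [K] r at the price of a constant factor. *)
pose kp := (Num.truncn K).+1.
have Kkp : K <= 2 ^+ kp.
  rewrite (le_trans (ltW (truncnS_gt K)))// -natrX ler_nat ltnW//.
  exact: ltn_expl.
exists (c * (c * th ^+ kp) * b); first by rewrite !mulr_gt0// exprn_gt0.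
move=> M; pose r := 2 ^+ M * A.
have M0 : 0 < 2 ^+ M :> R by rewrite exprn_gt0.
have r0 : 0 < r by exact: mulr_gt0.
have r20 : 0 < r ^+ 2 by exact: exprn_gt0.
pose S i := \bigcap_m dyadic_stay Y (2 * r ^+ 2) `[(- (2 ^+ i * A))%R, (K * r)%R] m.
pose J i := xi1 @^-1` `](2 ^+ i * A)%R, (2 ^+ i.+1 * A)%R].
pose H := xi2 @^-1` `](2 ^+ (M + kp) * A)%R, +oo[.
pose V i := J i `&` H `&` S i.
have mJ i : measurable (J i) by rewrite -[X in measurable X]setTI; exact: mx1.
have mH : measurable H by rewrite -[X in measurable X]setTI; exact: mx2.
have pS i : sigma_proc Y (S i).
  by apply: sigma_proc_dyadic_stay => //; rewrite mulr_ge0// ltW.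
have mS i : measurable (S i) by exact: (measurable_sigma_proc mY (pS i)).
have PH : ((c * th ^+ (M + kp))%:E <= P H)%E.
  have [h _] := tails _ Xf2 (M + kp)%N; apply: (le_trans h).
  apply: le_measure; rewrite ?inE//.
    by rewrite -[X in measurable X]setTI; exact: mx2.
  by move=> w; rewrite /H/= !in_itv/= andbT => /andP[].
rewrite (_ : c * _ * b * _ =
    \sum_(i < M.+1) c * th ^+ i * (c * th ^+ (M + kp)) * (b * (2 ^+ i / 2 ^+ M))); last first.
  rewrite mulr_suml mulr_sumr; apply: eq_bigr => i _.
  by rewrite exprD expr_div_n exprMn; field; rewrite gt_eqF.
apply: (probability_disjoint_sum (V := V)
  (v := fun i => c * th ^+ i * (c * th ^+ (M + kp)) * (b * (2 ^+ i / 2 ^+ M)))).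
- by apply: mE; exact: ltW.
- by move=> i; rewrite /V; apply: measurableI => //; exact: measurableI.
- apply/trivIsetP => i j _ _; rewrite neq_ltn => ij.
  have key a e w : (a < e)%N -> J a w -> J e w -> False.
    move=> ae; rewrite /J/= !in_itv/= => /andP[_ h1] /andP[h2 _].
    have : 2 ^+ a.+1 * A <= 2 ^+ e * A.
      by rewrite ler_pM2r// ler_eXn2l//; lra.
    by move=> h3; have := lt_le_trans h2 (le_trans h1 h3); rewrite ltxx.
  apply/seteqP; split=> // w [[[wi _] _] [[wj _] _]].
  by case/orP: ij => ij; [apply: (key i j w)|apply: (key j i w)].
- move=> i; rewrite ltnS => iM.
  rewrite /V ind; last exact: pS.
    + have a0 : 0 < 2 ^+ i * A by rewrite mulr_gt0// exprn_gt0.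
      have ar : 2 ^+ i * A <= r by rewrite ler_pM2r// ler_eXn2l//; lra.
      have := stay _ _ P Y BY r (2 ^+ i * A) r0 a0 ar.
      have -> : 2 ^+ i * A / r = 2 ^+ i / 2 ^+ M.
        by rewrite /r; field; rewrite !gt_eqF.
      have [h1 _] := tails _ Xf1 i.
      move=> h2; rewrite !EFinM lee_pmul//.
      * by rewrite -!EFinM lee_fin !mulr_ge0// ?exprn_ge0// ltW.
      * by rewrite -!EFinM lee_fin !mulr_ge0// ?invr_ge0 ?exprn_ge0// ltW.
      * by rewrite lee_pmul// -?EFinM ?lee_fin// mulr_ge0 ?exprn_ge0// ltW.
    + exact: sigma_rv_preimage.
    + exact: sigma_rv_preimage.
- move=> i _ w [[wJ wH] wS]; move: wJ wH; rewrite /J /H/= !in_itv/= andbT.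
  move=> /andP[x1 _] x2.
  apply: (dyadic_stay_exit cY _ _ wS) => //.
  + by rewrite mulr_gt0.
  + by rewrite -/r; lra.
  + apply: le_lt_trans x2.
    rewrite exprD mulrAC -/r mulrC ler_pM2l//.
Qed.

(** Endpoints fall into classes 0, ..., [M.+1]; the last collects all values above 2^M A and has no
    cap. *)
Let cap (A : R) (M i : nat) : option R :=
  if (i <= M)%N then Some (2 ^+ i * A) else None.

(** Class 0 collects all values up to [A] and has no floor; class i + 1 starts where class i is
    capped. *)
Let floor_set (A : R) (i : nat) : set R :=
  if i is i'.+1 then `](2 ^+ i' * A)%R, +oo[%classic else setT.

Let class_exists (A x : R) M : exists i, [/\ (i < M.+2)%N, floor_set A i x &
  forall a, cap A M i = Some a -> x <= a].
Proof.
pose q i := (i == M.+1) || (x <= 2 ^+ i * A).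
have exq : exists i, q i by exists M.+1; rewrite /q eqxx.
case: (ex_minnP exq) => i qi imin; exists i; split.
- by rewrite ltnS; apply: imin; rewrite /q eqxx.
- case: i qi imin => [|i] qi imin //=.
  rewrite in_itv/= andbT ltNge; apply/negP => xi.
  by have := imin i; rewrite /q xi orbT ltnn => /(_ isT).
- move=> a; rewrite /cap; case: ifPn => // iM [<-].
  by case/orP: qi => // /eqP iM1; rewrite iM1 ltnn in iM.
Qed.

Let cap_gt0 A M i a : 0 < A -> cap A M i = Some a -> 0 < a.
Proof.
move=> A0; rewrite /cap; case: ifP => // _ [<-].
by rewrite mulr_gt0// exprn_gt0.
Qed.

Let cap_le A M i j b : 0 < A -> (i <= j)%N -> cap A M j = Some b ->
  exists2 a, cap A M i = Some a & a <= b.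
Proof.
move=> A0 ij; rewrite /cap; case: ifP => // jM [<-].
rewrite (leq_trans ij jM); exists (2 ^+ i * A) => //.
by rewrite ler_pM2r// ler_eXn2l//; lra.
Qed.

(** For classes i <= j the bound has the product form [u i * v j], so the double sum factorises: [u]
    sums to order Q M / 2^M and [v] to order th^M. *)
Lemma exit_dyadic_upper (A c D : R) : 0 < A -> 0 < D ->
  (forall X, has_density P X f -> forall i : nat,
    ((c * th ^+ i)%:E <=
     P (X @^-1` `](2 ^+ i * A)%R, (2 ^+ i.+1 * A)%R]))%E /\
    (P (X @^-1` `](2 ^+ i * A)%R, +oo[) <= (D * th ^+ i)%:E)%E) ->
  exists2 U : R, 0 < U & forall M : nat,
    (P (E ((2 ^+ M * A) ^+ 2)) <= (U * (Q M * (th / 2) ^+ M))%:E)%E.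
Proof.
move=> A0 D0 tails.
have th0 : 0 < th by exact: powR_gt0.
(* [n - 1] exceeds p, hence 2^n th >= 2 and the sum of [v] is dominated by its last term. *)
pose n := (Num.truncn p).+2.
have n0 : (0 < n)%N by [].
have thn : 2 <= 2 ^+ n * th.
  have h : (2 ^+ n.-1)^-1 <= th.
    rewrite -powR_mulrn// -powRN ler_powR//; first by lra.
    by rewrite lerN2 ltW//; exact: truncnS_gt.
  rewrite -(ler_pM2l (_ : 0 < 2 ^+ n)) ?exprn_gt0// in h.
  by apply: le_trans h; rewrite /n exprS -mulrA divff ?mulr1// expf_neq0.
have [B B0 conf] := @confined_le R n n0.
(* sqrt 2 comes from sqrt s = r / sqrt 2; the maximum with 1 covers the uncapped class, whose
   [scaled] value is 1. *)
pose B1 := Num.max (B * Num.sqrt 2) 1.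
have B11 : 1 <= B1 by rewrite le_max lexx orbT.
have BB1 : B * Num.sqrt 2 <= B1 by rewrite le_max lexx.
have B10 : 0 < B1 by lra.
(* 1 covers class 0; class i + 1 has floor 2^i A, whose tail bound D th^i is (D / th) th^(i + 1). *)
pose D1 := Num.max 1 (D / th).
have D11 : 1 <= D1 by rewrite le_max lexx.
have DD1 : D / th <= D1 by rewrite le_max lexx orbT.
have D10 : 0 < D1 by lra.
(* 2 counts the two orders of the endpoints; the last two factors absorb sums that run to
   [M + 1]. *)
pose U := 2 * D1 ^+ 2 * B1 ^+ n.+1 * (1 + 2 * th) * (2 ^+ n * th) ^+ 2.
exists U.
  have t1 : 0 < 1 + 2 * th by lra.
  have t2 : 0 < (2 ^+ n * th) ^+ 2 by rewrite exprn_gt0//; lra.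
  rewrite /U; apply: mulr_gt0 t2; apply: mulr_gt0 t1.
  apply: mulr_gt0; last exact: exprn_gt0.
  by apply: mulr_gt0 => //; exact: exprn_gt0.
move=> M; pose r := 2 ^+ M * A.
have M0 : 0 < 2 ^+ M :> R by rewrite exprn_gt0.
have r0 : 0 < r by exact: mulr_gt0.
pose s := r ^+ 2 / 2.
have s0 : 0 < s by rewrite divr_gt0// exprn_gt0.
have s2 : 2 * s = r ^+ 2 by rewrite /s mulrC divfK.
have sqs : Num.sqrt s = r / Num.sqrt 2.
  by rewrite /s sqrtrM ?sqr_ge0// sqrtr_sqr gtr0_norm// sqrtrV.
have sq2 : 0 < Num.sqrt 2 :> R by rewrite sqrtr_gt0.
have floorP X i : has_density P X f ->
    (P (X @^-1` floor_set A i) <= (D1 * th ^+ i)%:E)%E.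
  move=> Xf; have [mX _] := Xf; case: i => [|i].
    apply: (@le_trans _ _ 1%E); last by rewrite lee_fin expr0 mulr1.
    by rewrite /= preimage_setT; exact: probability_le1.
  have [_ h] := tails _ Xf i; apply: (le_trans h).
  rewrite lee_fin exprS mulrA ler_pM2r ?exprn_gt0//.
  by rewrite -ler_pdivrMr.
have floor0 i : 0 <= D1 * th ^+ i by rewrite mulr_ge0 ?exprn_ge0// ltW.
have scap i : (i < M.+2)%N -> 0 <= scaled B s (cap A M i) <= B1 * (2 ^+ i / 2 ^+ M).
  rewrite ltnS => iM; have i0 : 0 < 2 ^+ i :> R by rewrite exprn_gt0.
  rewrite /scaled /cap; case: leqP => iM'.
    rewrite sqs.
    have -> : B * (2 ^+ i * A / (r / Num.sqrt 2)) = B * Num.sqrt 2 * (2 ^+ i / 2 ^+ M).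
      by rewrite /r; field; rewrite !gt_eqF.
    by rewrite ler_pM2r ?divr_gt0// BB1 andbT !mulr_ge0 ?invr_ge0// ltW.
  have -> : i = M.+1 by apply/eqP; rewrite eqn_leq iM.
  by rewrite exprS mulfK ?gt_eqF// ler01/=; lra.
pose u (i : nat) := th ^+ i * (2 ^+ i / 2 ^+ M).
pose v (i : nat) := th ^+ i * (2 ^+ i / 2 ^+ M) ^+ n.
have u0 i : 0 <= u i by rewrite /u mulr_ge0 ?divr_ge0 ?exprn_ge0// ltW.
have v0 i : 0 <= v i by rewrite /v mulr_ge0 ?exprn_ge0 ?divr_ge0 ?exprn_ge0// ltW.
pose K := D1 ^+ 2 * B1 ^+ n.+1.
have K0 : 0 <= K by rewrite /K mulr_ge0 ?exprn_ge0// ltW.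
(* The smaller endpoint is never crossed during [0, s] while the blocks in
   [s, 2 s] see only the larger one; Z is Y or -Y accordingly. *)
have piece (Z : R -> T -> R) (X X' : T -> R) (i j : nat) :
    brownian_motion P Z -> has_density P X f -> has_density P X' f ->
    (forall N, (0 < N)%N -> sigma_proc Y (confined Z s N n (cap A M i) (cap A M j))) ->
    (forall B B' S, measurable B -> measurable B' -> sigma_proc Y S ->
      P (X @^-1` B `&` X' @^-1` B' `&` S) =
      (P (X @^-1` B) * P (X' @^-1` B') * P S)%E) ->
    (i < M.+2)%N -> (j < M.+2)%N -> (i <= j)%N ->
    exists W, [/\ measurable W, (P W <= (K * (u i * v j))%:E)%E &
      forall w, (forall q, 0 <= q -> q <= 2 * s -> - X w < Z q w < X' w) ->
        floor_set A i (X w) -> (forall a, cap A M i = Some a -> X w <= a) ->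
        floor_set A j (X' w) -> (forall a, cap A M j = Some a -> X' w <= a) -> W w].
  move=> BZ Xf X'f pc indX iM jM ij.
  have [mX _] := Xf; have [mX' _] := X'f.
  have mfl k : measurable (floor_set A k) by case: k => [|k]; [exact: measurableT|exact: measurable_itv].
  have [N N0 PN] := conf _ _ P Z BZ s (cap A M i) (cap A M j) s0
    (fun a => cap_gt0 A0) (fun a => cap_gt0 A0).
  exists (X @^-1` floor_set A i `&` X' @^-1` floor_set A j `&`
    confined Z s N n (cap A M i) (cap A M j)); split.
  - apply: measurableI; last exact: (measurable_sigma_proc mY (pc N N0)).
    by apply: measurableI; rewrite -[X in measurable X]setTI; [exact: mX|exact: mX'].
  - rewrite (indX _ _ _ (mfl i) (mfl j) (pc N N0)).
    have /andP[si0 si] := scap i iM; have /andP[sj0 sj] := scap j jM.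
    have h3 : (P (confined Z s N n (cap A M i) (cap A M j)) <=
        (B1 * (2 ^+ i / 2 ^+ M) * (B1 * (2 ^+ j / 2 ^+ M)) ^+ n)%:E)%E.
      apply: (le_trans PN); rewrite lee_fin ler_pM// ?exprn_ge0//.
      by rewrite lerXn2r ?nnegrE// (le_trans sj0).
    have -> : K * (u i * v j) = D1 * th ^+ i * (D1 * th ^+ j) *
        (B1 * (2 ^+ i / 2 ^+ M) * (B1 * (2 ^+ j / 2 ^+ M)) ^+ n).
      by rewrite /K /u /v (exprMn _ B1) (exprS B1); ring.
    rewrite EFinM lee_pmul ?mule_ge0 ?measure_ge0//.
    by rewrite EFinM lee_pmul ?measure_ge0 ?floorP.
  - move=> w hw fi ci fj cj; split=> //.
    apply: (@confined_cover R d T Z s N n _ _ (X w) (X' w)) => //.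
    (* As i <= j, both endpoints are at most the cap b of class j, so their sum is at most 2b. *)
    move=> b jb; have [a ia ab] := cap_le A0 ij jb.
    by have := ci a ia; have := cj b jb; lra.
(* The bound is symmetrised to hold whichever class is larger. [choice] asks for a set at every
   pair, so pairs out of range receive the empty set. *)
have X1X2 : forall ij : nat * nat, exists W, [/\ measurable W,
    (P W <= (K * (u ij.1 * v ij.2 + u ij.2 * v ij.1))%:E)%E &
    (ij.1 < M.+2)%N -> (ij.2 < M.+2)%N ->
    forall w, (forall q, 0 <= q -> q <= 2 * s -> - xi1 w < Y q w < xi2 w) ->
        floor_set A ij.1 (xi1 w) -> (forall a, cap A M ij.1 = Some a -> xi1 w <= a) ->
        floor_set A ij.2 (xi2 w) -> (forall a, cap A M ij.2 = Some a -> xi2 w <= a) -> W w].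
  move=> [i j] /=.
  have [iM|iM] := ltnP i M.+2; last first.
    exists set0; split=> //; rewrite measure0 lee_fin.
    by rewrite mulr_ge0// addr_ge0// mulr_ge0.
  have [jM|jM] := ltnP j M.+2; last first.
    exists set0; split=> //; rewrite measure0 lee_fin.
    by rewrite mulr_ge0// addr_ge0// mulr_ge0.
  have [ij|ji] := leqP i j.
    have [||W [mW PW hW]] := piece Y xi1 xi2 i j BY Xf1 Xf2 _ _ iM jM ij.
    - by move=> N N0; exact: sigma_proc_confined.
    - by move=> B2 B2' S mB2 mB2' pS; apply: ind => //; exact: sigma_rv_preimage.
    exists W; split; [exact: mW| |by move=> _ _; exact: hW].
    apply: (le_trans PW); rewrite lee_fin ler_wpM2l// lerDl.
    by rewrite mulr_ge0.
  have [||W [mW PW hW]] := piece (fun s w => - Y s w) xi2 xi1 j i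
    (brownian_opp BY) Xf2 Xf1 _ _ jM iM (ltnW ji).
  - by move=> N N0; exact: sigma_proc_confinedN.
  - move=> B2 B2' S mB2 mB2' pS.
    rewrite (setIC (xi2 @^-1` B2)) ind//; [|exact: sigma_rv_preimage..].
    by rewrite (muleC (P (xi1 @^-1` _))).
  exists W; split; [exact: mW| |].
    apply: (le_trans PW); rewrite lee_fin ler_wpM2l// lerDr.
    by rewrite mulr_ge0.
  move=> _ _ w hw f1 c1 f2 c2; apply: hW => // q q0 qs.
  by have /andP[h1 h2] := hw q q0 qs; apply/andP; split; lra.
have [W hW] := choice X1X2.
have PE := probability_cover2 (P := P) (n := M.+2) (E := E (r ^+ 2)) (W := W)
  (w := fun ij => K * (u ij.1 * v ij.2 + u ij.2 * v ij.1)).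
apply: (le_trans (PE _ _ _ _)).
- by apply: mE; rewrite exprn_ge0// ltW.
- by move=> ij; have [] := hW ij.
- by move=> ij; have [] := hW ij.
- move=> w Ew.
  have [i [iM fi ci]] := class_exists A (xi1 w) M.
  have [j [jM fj cj]] := class_exists A (xi2 w) M.
  exists i, j; split=> //; have [_ _] := hW (i, j); apply=> //.
  by move=> q q0 qs; apply: (exit_time_gt Ew) => //; rewrite -s2.
rewrite lee_fin /=.
have -> : \sum_(i < M.+2) \sum_(j < M.+2) K * (u i * v j + u j * v i) =
    2 * K * ((\sum_(i < M.+2) u i) * (\sum_(j < M.+2) v j)).
  transitivity (\sum_(i < M.+2) \sum_(j < M.+2) K * (u i * v j) +
      \sum_(i < M.+2) \sum_(j < M.+2) K * (u j * v i)).
    rewrite -big_split/=; apply: eq_bigr => i _.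
    by rewrite -big_split/=; apply: eq_bigr => j _; exact: mulrDr.
  rewrite [X in _ + X]exchange_big/=.
  have -> : \sum_(i < M.+2) \sum_(j < M.+2) K * (u i * v j) =
      K * ((\sum_(i < M.+2) u i) * (\sum_(j < M.+2) v j)).
    by rewrite big_distrlr/= mulr_sumr; apply: eq_bigr => i _; rewrite mulr_sumr.
  ring.
have su : \sum_(i < M.+2) u i <= (1 + 2 * th) * Q M / 2 ^+ M.
  rewrite (_ : \sum_(i < M.+2) u i = (\sum_(i < M.+2) (2 * th) ^+ i) / 2 ^+ M).
    rewrite ler_pM2r ?invr_gt0//; apply: geom_sumS_le.
    by rewrite mulr_ge0// ltW.
  rewrite mulr_suml; apply: eq_bigr => i _.
  by rewrite /u exprMn; ring.
have sv : \sum_(j < M.+2) v j <= (2 ^+ n * th) ^+ 2 * th ^+ M.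
  rewrite (_ : \sum_(j < M.+2) v j =
      (\sum_(j < M.+2) (2 ^+ n * th) ^+ j) / (2 ^+ n) ^+ M).
    rewrite ler_pdivrMr ?exprn_gt0 ?exprn_gt0//.
    apply: (le_trans (geom_sum_le _ thn)).
    rewrite -(addn2 M) exprD [(_ * th) ^+ M]exprMn le_eqVlt; apply/orP; left.
    by apply/eqP; ring.
  rewrite mulr_suml; apply: eq_bigr => i _.
  rewrite /v expr_div_n [(_ * th) ^+ i]exprMn -!exprM (mulnC i) (mulnC M) mulrA.
  by congr (_ / _); exact: mulrC.
have su0 : 0 <= \sum_(i < M.+2) u i by apply: sumr_ge0.
have sv0 : 0 <= \sum_(i < M.+2) v i by apply: sumr_ge0.
apply: (@le_trans _ _ (2 * K * (((1 + 2 * th) * Q M / 2 ^+ M) *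
    ((2 ^+ n * th) ^+ 2 * th ^+ M)))).
  by apply: ler_wpM2l; [rewrite mulr_ge0|exact: ler_pM].
rewrite le_eqVlt; apply/orP; left; apply/eqP.
by rewrite /U /K expr_div_n; field; rewrite gt_eqF.
Qed.
End dyadic_times.

(** * Asymptotic rate *)

Section rate_comparison.
Context (R : realType).

Lemma dyadic_bracket (A t : R) : 0 < A -> A ^+ 2 <= t ->
  exists M, (2 ^+ M * A) ^+ 2 <= t < (2 ^+ M.+1 * A) ^+ 2.
Proof.
move=> A0 At.
have exm : exists m, t < (2 ^+ m * A) ^+ 2.
  pose m := Num.truncn (t / A ^+ 2); exists m.+1.
  rewrite exprMn -ltr_pdivrMr ?exprn_gt0//; apply: (lt_trans (truncnS_gt _)).
  rewrite -exprM -natrX ltr_nat; apply: leq_trans (ltn_expl _ (ltnSn 1)) _.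
  by rewrite leq_exp2l// muln2 -addnn leq_addr.
case: (ex_minnP exm) => m tm mmin.
case: m tm mmin => [|M] tm mmin.
  by move: tm; rewrite expr0 mul1r ltNge At.
exists M; rewrite tm andbT leNgt; apply/negP => h.
by have := mmin M h; rewrite ltnn.
Qed.

Lemma geom_sumE (q : R) n : (q - 1) * \sum_(i < n) q ^+ i = q ^+ n - 1.
Proof. by rewrite -subrX1. Qed.

Lemma powR_bracket (A e t : R) M : 0 < A -> 0 < e ->
  (2 ^+ M * A) ^+ 2 <= t -> t < (2 ^+ M.+1 * A) ^+ 2 ->
  (A ^+ 2) `^ (- e) * (2 `^ (- e)) ^+ 2 * ((2 `^ (- e)) ^+ 2) ^+ M <= t `^ (- e) /\
  t `^ (- e) <= (A ^+ 2) `^ (- e) * ((2 `^ (- e)) ^+ 2) ^+ M.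
Proof.
move=> A0 e0 t1 t2.
have tM m : ((2 ^+ m * A) ^+ 2) `^ (- e) = (A ^+ 2) `^ (- e) * ((2 `^ (- e)) ^+ 2) ^+ m.
  by rewrite exprMn -(exprM 2 m 2) powR_double ?exprn_gt0// mulnC exprM.
have mono z w : 0 < z -> z <= w -> w `^ (- e) <= z `^ (- e).
  move=> z0 zw; rewrite !powRN lef_pV2 ?posrE ?powR_gt0//; last exact: lt_le_trans zw.
  apply: ge0_ler_powR => //; rewrite ?nnegrE; [exact: ltW|exact: ltW|].
  by rewrite ltW// (lt_le_trans z0).
have t0 : 0 < (2 ^+ M * A) ^+ 2 by rewrite exprn_gt0// mulr_gt0// exprn_gt0.
split.
  by rewrite -mulrA -exprS -tM; apply: mono; [exact: lt_le_trans t1|exact: ltW].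
by rewrite -tM; exact: mono.
Qed.

Local Notation th p := (2 `^ (- p) : R).
Local Notation Q p M := (\sum_(i < M.+1) (2 * th p) ^+ i).

(** For t between consecutive dyadic times t^(-e) is of order 4^(-e M), so comparing two sequences
    in M is enough. *)
Lemma powR_comparison (p e A K : R) : 0 < A -> 0 < e -> 0 < K ->
  (forall M, ((th e) ^+ 2) ^+ M <= Q p M * (th p / 2) ^+ M) ->
  (forall M, Q p M * (th p / 2) ^+ M <= K * ((th e) ^+ 2) ^+ M) ->
  exists k1 k2, [/\ 0 < k1, 0 < k2 & forall M t,
    (2 ^+ M * A) ^+ 2 <= t -> t < (2 ^+ M.+1 * A) ^+ 2 ->
    [/\ 0 < t `^ (- e), k1 * t `^ (- e) <= Q p M * (th p / 2) ^+ M &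
     Q p M * (th p / 2) ^+ M <= k2 * t `^ (- e)]].
Proof.
move=> A0 e0 K0 h1 h2.
pose a := (A ^+ 2) `^ (- e).
have a0 : 0 < a by rewrite powR_gt0// exprn_gt0.
pose x := (th e) ^+ 2.
have x0 : 0 < x by rewrite exprn_gt0// powR_gt0.
exists a^-1, (K / (a * x)); split; [by rewrite invr_gt0|by rewrite divr_gt0// mulr_gt0|].
move=> M t t1 t2; have [b1 b2] := powR_bracket A0 e0 t1 t2.
rewrite -/a -/x in b1 b2.
have xM : 0 < x ^+ M by rewrite exprn_gt0.
split.
- by apply: lt_le_trans b1; rewrite !mulr_gt0.
- by apply: le_trans (h1 M); rewrite mulrC ler_pdivrMr// mulrC.
- apply: (le_trans (h2 M)); rewrite -/x -mulrA ler_pM2l//.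
  by rewrite mulrC ler_pdivlMr ?mulr_gt0// mulrC.
Qed.

Lemma rate_comparison (p A : R) : 0 < p -> 0 < A ->
  exists k1 k2 M0, [/\ 0 < k1, 0 < k2 & forall M t, (M0 <= M)%N ->
    (2 ^+ M * A) ^+ 2 <= t -> t < (2 ^+ M.+1 * A) ^+ 2 ->
    [/\ 0 < rate p t, k1 * rate p t <= Q p M * (th p / 2) ^+ M &
     Q p M * (th p / 2) ^+ M <= k2 * rate p t]].
Proof.
move=> p0 A0.
have th0 : 0 < th p by exact: powR_gt0.
pose q := 2 * th p.
have q0 : 0 < q by rewrite mulr_gt0.
have qE : q = 2 `^ (1 - p).
  by rewrite powRD ?powRr1//; apply/implyP => _; rewrite pnatr_eq0.
have qth M : q ^+ M * (th p / 2) ^+ M = (th p ^+ 2) ^+ M.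
  by rewrite -exprMn; congr (_ ^+ _); rewrite /q; field.
have thM M : 0 < (th p / 2) ^+ M by rewrite exprn_gt0// divr_gt0.
rewrite /rate; case: (ltgtP p 1) => p1.
(* p < 1: the sum is of the order of its last term q^M, and q^M (th / 2)^M = th^(2 M). *)
- have q1 : 1 < q.
    rewrite qE /powR pnatr_eq0/= expR_gt1 mulr_gt0 ?subr_gt0// ln_gt0//; lra.
  have [] := @powR_comparison p p A (q / (q - 1)) A0 p0 _ _ _.
  + by rewrite divr_gt0// subr_gt0.
  + move=> M; rewrite -qth ler_pM2r// big_ord_recr/= -/q lerDr.
    by apply: sumr_ge0 => i _; rewrite exprn_ge0// ltW.
  + move=> M; rewrite -qth mulrA ler_pM2r// -/q mulrAC ler_pdivlMr ?subr_gt0//.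
    by rewrite mulrC geom_sumE exprS lerBlDr lerDl.
  move=> k1 [k2 [k10 k20 h]]; exists k1, k2, 0%N; split=> // M t _; exact: h.
(* p > 1: the sum lies between 1 and 1 / (1 - q), and th / 2 = 2^(-(p + 1)) gives the exponent (p +
   1) / 2. *)
- have q1 : q < 1.
    rewrite qE /powR pnatr_eq0/= expR_lt1 nmulr_rlt0 ?ln_gt0 ?subr_lt0//; lra.
  have e0 : 0 < (p + 1) / 2 by lra.
  have ee : th ((p + 1) / 2) ^+ 2 = th p / 2.
    rewrite -powR_mulrn ?powR_ge0// -powRrM.
    rewrite (_ : - ((p + 1) / 2) * 2 = - p + - 1); last by field.
    rewrite powRD; last by apply/implyP => _; rewrite pnatr_eq0.
    by congr (_ * _); rewrite powRN powRr1.
  have [] := @powR_comparison p ((p + 1) / 2) A (1 - q)^-1 A0 e0 _ _ _.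
  + by rewrite invr_gt0 subr_gt0.
  + move=> M; rewrite ee ler_peMl ?(ltW (thM M))//.
    by apply: geom_sum_ge1; exact: ltW.
  + move=> M; rewrite ee ler_pM2r// -/q -[leRHS]mul1r ler_pdivlMr ?subr_gt0//.
    rewrite -(opprB q) mulrN mulrC geom_sumE opprB lerBlDr lerDl.
    by rewrite exprn_ge0// ltW.
  move=> k1 [k2 [k10 k20 h]]; exists k1, k2, 0%N; split=> // M t _; exact: h.
- have q1 : q = 1 by rewrite qE p1 subrr powRr0.
  have thE : th p / 2 = 4^-1.
    by have : 2 * th p = 1 by []; lra.
  have QE M : Q p M = M.+1%:R.
    under eq_bigr do rewrite -/q q1 expr1n.
    by rewrite sumr_const card_ord.
  pose l := ln (4 : R); pose a := ln (A ^+ 2).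
  have l0 : 0 < l by rewrite ln_gt0//; lra.
  have A20 : 0 < A ^+ 2 by rewrite exprn_gt0.
  have lnM m : ln ((2 ^+ m * A) ^+ 2) = m%:R * l + a.
    rewrite exprMn -exprM mulnC exprM (_ : 2 ^+ 2 = 4); last by ring.
    by rewrite lnM ?posrE ?exprn_gt0// lnXn// mulr_natl.
  (* p = 1: ln t lies between M l + a and (M + 1) l + a. The threshold ensures M >= 1 and |a| <= M l
     / 2, whence M + 1 <= 4 ln t / l and ln t <= 2 l (M + 1); the other factors 4 and A^2 come from
     the bracket on t. *)
  exists (A ^+ 2 / (2 * l)), (16 * A ^+ 2 / l), (Num.truncn (2 * `|a| / l)).+1.
  split.
  + by rewrite divr_gt0// mulr_gt0.
  + by rewrite divr_gt0// mulr_gt0.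
  move=> M t MM t1 t2.
  have M1 : 1 <= M%:R :> R by rewrite ler1n (leq_trans _ MM).
  have Ma : 2 * `|a| <= M%:R * l.
    rewrite -ler_pdivrMr//; apply: (le_trans (ltW (truncnS_gt _))).
    by rewrite ler_nat.
  have M4 : 0 < 4 ^+ M :> R by rewrite exprn_gt0.
  have tE m : (2 ^+ m * A) ^+ 2 = 4 ^+ m * A ^+ 2.
    by rewrite exprMn -exprM mulnC exprM (_ : 2 ^+ 2 = 4); last by ring.
  have t0 : 0 < t by apply: lt_le_trans t1; rewrite tE mulr_gt0.
  have ln1 : M%:R * l + a <= ln t.
    by rewrite -lnM ler_ln ?posrE// tE mulr_gt0.
  have ln2 : ln t <= (M%:R + 1) * l + a.
    by rewrite natr1 -lnM ler_ln ?posrE ?(ltW t2)// tE mulr_gt0// exprn_gt0.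
  have a1 := ler_norm a; have a2 := ler_norm (- a); rewrite normrN in a2.
  have Ml : l <= M%:R * l by rewrite ler_peMl// ltW.
  rewrite thE QE -(natr1 M).
  rewrite tE in t1; rewrite tE exprS in t2.
  rewrite exprVn.
  have lt0 : 0 < ln t by lra.
  split.
  + by rewrite divr_gt0.
  + rewrite mulrA ler_pdivrMr// [leRHS]mulrAC ler_pdivlMr//.
    have -> : A ^+ 2 / (2 * l) * ln t * 4 ^+ M = (4 ^+ M * A ^+ 2) * (ln t / (2 * l)).
      by field; rewrite gt_eqF.
    rewrite (mulrC (M%:R + 1)); apply: ler_pM => //.
    * by rewrite mulr_ge0// ltW.
    * by rewrite divr_ge0// ltW// mulr_gt0.
    * by rewrite ler_pdivrMr ?mulr_gt0//; nra.
  + rewrite mulrA ler_pdivlMr// mulrAC ler_pdivrMr//.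
    have -> : 16 * A ^+ 2 / l * ln t * 4 ^+ M = (4 * 4 ^+ M * A ^+ 2) * (4 * ln t / l).
      by field; rewrite gt_eqF.
    rewrite mulrC; apply: ler_pM => //; [exact: ltW|exact: ltW|].
    by rewrite ler_pdivlMr//; lra.
Qed.
End rate_comparison.

(** * Interpolation between dyadic times *)

Unset Implicit Arguments.

Theorem theorem3p1 (R : realType) (d : measure_display) (T : measurableType d)
  (P : probability T R) (f : R -> R) (C p : R) (xi1 xi2 : T -> R)
  (Y : R -> T -> R) :
  0 < C -> 0 < p ->
  f t / (C * t `^ (- (p + 1))) @[t --> +oo] --> (1 : R) ->
  has_density P xi1 f -> has_density P xi2 f ->
  P [set w | xi1 w <= 0] = 0%E -> P [set w | xi2 w <= 0] = 0%E ->
  brownian_motion P Y ->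
  indep3 P (sigma_rv xi1) (sigma_rv xi2) (sigma_proc Y) ->
  exists C1 C2 : R, 0 < C1 /\ C1 <= C2 /\
    \forall t \near +oo,
      C1 <= fine (P [set w | (t%:E < exit_time Y xi1 xi2 w)%E]) / rate p t <= C2.
Proof.
move=> C0 p0 fC Xf1 Xf2 _ _ BY ind.
have [A [c [D [A0 c0 D0 tails]]]] := pareto_tails C0 p0 fC.
have tailsP X (Xf : has_density P X f) := tails d T P X Xf.
have [L L0 low] := exit_dyadic_lower Xf1 Xf2 BY ind A0 c0 tailsP.
have [U U0 upp] := exit_dyadic_upper Xf1 Xf2 BY ind A0 D0 tailsP.
have [k1 [k2 [M0 [k10 k20 cmp]]]] := rate_comparison p0 A0.
set th : R := 2 `^ (- p) in low upp cmp.
have th0 : 0 < th by exact: powR_gt0.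
pose Q M := \sum_(i < M.+1) (2 * th) ^+ i.
pose E t := [set w | (t%:E < exit_time Y xi1 xi2 w)%E].
have [mY [_ [cY _]]] := BY.
have [mx1 _] := Xf1; have [mx2 _] := Xf2.
have mE t : 0 <= t -> measurable (E t) by exact: measurable_exit_gt.
have Efin t : 0 <= t -> P (E t) = (fine (P (E t)))%:E.
  by move=> t0; rewrite fineK// fin_num_measure//; exact: mE.
have Emono s t : 0 <= s -> s <= t -> fine (P (E t)) <= fine (P (E s)).
  move=> s0 st; have t0 := le_trans s0 st.
  rewrite -lee_fin -!Efin//; apply: le_measure; rewrite ?inE; [exact: mE|exact: mE|].
  by move=> w; rewrite /E/=; apply: le_lt_trans; rewrite lee_fin.
(* The lower bound is read at the next dyadic time [M.+1], which costs one factor [th / 2] while the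
   sum [Q] only grows. *)
pose C1 := L * (th / 2) * k1.
have C10 : 0 < C1 by rewrite !mulr_gt0// divr_gt0.
exists C1, (Num.max C1 (U * k2)); split=> //; split; first by rewrite le_max lexx.
exists ((2 ^+ M0 * A) ^+ 2); split; first exact: num_real.
move=> t M0t.
have dy0 m : 0 < (2 ^+ m * A) ^+ 2 by rewrite exprn_gt0// mulr_gt0// exprn_gt0.
have At : A ^+ 2 <= t.
  apply: le_trans (ltW M0t); rewrite exprMn ler_peMl ?sqr_ge0//.
  by rewrite exprn_ege1// exprn_ege1//; lra.
have [M /andP[t1 t2]] := dyadic_bracket A0 At.
have MM : (M0 <= M)%N.
  rewrite leqNgt; apply/negP => MM0.
  have : (2 ^+ M.+1 * A) ^+ 2 <= (2 ^+ M0 * A) ^+ 2.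
    rewrite ler_sqr ?nnegrE ?mulr_ge0 ?exprn_ge0 ?(ltW A0)//.
    by rewrite ler_pM2r// ler_eXn2l//; lra.
  by move=> h; have := lt_trans (lt_le_trans t2 h) M0t; rewrite ltxx.
have [r0 r1 r2] := cmp M t MM t1 t2.
have t0 : 0 <= t by apply: le_trans t1; exact: ltW.
rewrite ler_pdivlMr// ler_pdivrMr//; apply/andP; split.
  apply: (@le_trans _ _ (fine (P (E ((2 ^+ M.+1 * A) ^+ 2))))); last first.
    by apply: Emono => //; exact: ltW.
  have := low M.+1; rewrite (Efin _ (ltW (dy0 _))) lee_fin; apply: le_trans.
  rewrite /C1 -!mulrA ler_pM2l//.
  apply: (@le_trans _ _ (th / 2 * (Q M * (th / 2) ^+ M))).
    by rewrite [leLHS]mulrA ler_pM2l ?divr_gt0.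
  rewrite exprS [leRHS]mulrCA ler_pM2l ?divr_gt0// ler_pM2r ?exprn_gt0 ?divr_gt0//.
  by rewrite /Q [leRHS]big_ord_recr/= lerDl exprn_ge0// mulr_ge0// ltW.
apply: (@le_trans _ _ (fine (P (E ((2 ^+ M * A) ^+ 2))))).
  by apply: Emono => //; exact: ltW.
have := upp M; rewrite (Efin _ (ltW (dy0 _))) lee_fin => /le_trans; apply.
apply: (@le_trans _ _ (U * (k2 * rate p t))); first by rewrite ler_pM2l.
by rewrite mulrA ler_pM2r// le_max lexx orbT.
Qed.
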